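(* Let $r\ge3$ be odd, $\zeta=e^{2\pi i/r}$, $g\ge1$. For all vectors $\boldsymbol\ell,\boldsymbol m,\boldsymbol n$ of $g$ nonnegative integer coordinates, in $\mathrm{ad}^{\otimes g}$ (with $\mathrm{ad}$ the adjoint representation of $\mathfrak u_\zeta$) one has $$E\triangleright(E^{\boldsymbol\ell}T_{\boldsymbol m}F^{(\boldsymbol n)})=\sum_{j=1}^g\zeta^{2|\boldsymbol\ell-\boldsymbol n|_{>j}}\Big(\zeta^{2(m_j-n_j)}E^{\boldsymbol\ell+\boldsymbol e_j}T_{\boldsymbol m}F^{(\boldsymbol n)}-\zeta^{2(m_j-n_j+1)}E^{\boldsymbol\ell+\boldsymbol e_j}T_{\boldsymbol m+\boldsymbol e_j}F^{(\boldsymbol n)}-\{2m_j-n_j+1\}_\zeta\,\zeta^{2(m_j-n_j+1)}E^{\boldsymbol\ell}T_{\boldsymbol m}F^{(\boldsymbol n-\boldsymbol e_j)}\Big),$$ $$F^{(1)}\triangleright(E^{\boldsymbol\ell}T_{\boldsymbol m}F^{(\boldsymbol n)})=\sum_{j=1}^g\zeta^{-2|\boldsymbol\ell-\boldsymbol n|_{<j}}\Big(-[n_j+1]_\zeta\zeta^{-2(\ell_j-n_j)}E^{\boldsymbol\ell}T_{\boldsymbol m}F^{(\boldsymbol n+\boldsymbol e_j)}+[n_j+1]_\zeta E^{\boldsymbol\ell}T_{\boldsymbol m+\boldsymbol e_j}F^{(\boldsymbol n+\boldsymbol e_j)}-[\ell_j]_\zeta\{\ell_j-2m_j-1\}_\zeta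 E^{\boldsymbol\ell-\boldsymbol e_j}T_{\boldsymbol m}F^{(\boldsymbol n)}\Big),$$ $$K\triangleright(E^{\boldsymbol\ell}T_{\boldsymbol m}F^{(\boldsymbol n)})=\zeta^{2|\boldsymbol\ell-\boldsymbol n|}E^{\boldsymbol\ell}T_{\boldsymbol m}F^{(\boldsymbol n)}.$$
   Context: $\mathfrak u_\zeta$ is the $\mathbb C$-algebra with generators $E,F^{(1)},K$ and relations $E^r=(F^{(1)})^r=0$, $K^r=1$, $KEK^{-1}=\zeta^2E$, $KF^{(1)}K^{-1}=\zeta^{-2}F^{(1)}$, $[E,F^{(1)}]=K-K^{-1}$, with Hopf structure $\Delta(E)=E\otimes K+1\otimes E$, $\Delta(F^{(1)})=K^{-1}\otimes F^{(1)}+F^{(1)}\otimes1$, $\Delta(K)=K\otimes K$, $S(E)=-EK^{-1}$, $S(F^{(1)})=-KF^{(1)}$, $S(K)=K^{-1}$. $\{n\}_\zeta=\zeta^n-\zeta^{-n}$, $[n]_\zeta=\{n\}_\zeta/\{1\}_\zeta$. $F^{(a)}=(F^{(1)})^a/[a]_\zeta!$ for $0\le a\le r-1$, $F^{(a)}=0$ otherwise. $T_a=\frac1r\sum_{b=0}^{r-1}\zeta^{2ab}K^b$ (index mod $r$). $\mathrm{ad}$ is $\mathfrak u_\zeta$ with $x\triangleright y=x_{(1)}yS(x_{(2)})$ and $\mathrm{ad}^{\otimes g}$ carries the action by the iterated coproduct. $E^{\boldsymbol\ell}T_{\boldsymbol m}F^{(\boldsymbol n)}=\bigotimes_{j=1}^gE^{\ell_j}T_{m_j}F^{(n_j)}$;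 negative powers of $E$ (which only occur with zero coefficient) are read as zero. $|\boldsymbol x|=\sum_kx_k$, $|\boldsymbol x|_{<j}=\sum_{k<j}x_k$, $|\boldsymbol x|_{>j}=\sum_{k>j}x_k$; $\boldsymbol e_j$ is the $j$-th standard vector.
   Formalization: The formula for E is stated only when no coordinate n_j equals r; with F^(r)=0 it fails there (g=1, l=m=0, n=r: the left side is 0, but the right side is a nonzero multiple of T_0 F^(r-1)). *)

(* Defs.v *)
From HB Require Import structures.
From mathcomp Require Import all_boot all_order all_algebra.
From mathcomp Require Import boolp reals trigo.
From mathcomp Require Import complex ring lra.

Set Implicit Arguments.
Unset Strict Implicit.
Unset Printing Implicit Defensive.

Import Order.TTheory GRing.Theory Num.Theory.
Local Open Scope ring_scope.
Local Open Scope quotient_scope.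
(* k-algebras given by generators and relations: formal expressions in the    *)
(* generators, modulo the congruence generated by the relations and the       *)
(* axioms of unital associative k-algebras.                                   *)
Section Presentation.
Variables (k : fieldType) (G : Type).

Inductive term :=
  | tGen of G
  | tZero
  | tOne
  | tAdd of term & term
  | tMul of term & term
  | tScale of k & term.

Definition tSub s t := tAdd s (tScale (-1) t).
Definition tExp t n := iter n (tMul t) tOne.

Variable rel : term -> term -> Prop.

Inductive tcongr : term -> term -> Prop :=
  | tc_rel s t : rel s t -> tcongr s t
  | tc_refl t : tcongr t t
  | tc_sym s t : tcongr s t -> tcongr t s
  | tc_trans s t u : tcongr s t -> tcongr t u -> tcongr s u
  | tc_add s s' t t' :
      tcongr s s' -> tcongr t t' -> tcongr (tAdd s t) (tAdd s' t')
  | tc_mul s s' t t' :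
      tcongr s s' -> tcongr t t' -> tcongr (tMul s t) (tMul s' t')
  | tc_scale a s s' : tcongr s s' -> tcongr (tScale a s) (tScale a s')
  | tc_addA s t u : tcongr (tAdd s (tAdd t u)) (tAdd (tAdd s t) u)
  | tc_addC s t : tcongr (tAdd s t) (tAdd t s)
  | tc_add0 t : tcongr (tAdd tZero t) t
  | tc_scale0 t : tcongr (tScale 0 t) tZero
  | tc_scale1 t : tcongr (tScale 1 t) t
  | tc_scaleA a b t : tcongr (tScale a (tScale b t)) (tScale (a * b) t)
  | tc_scaleDr a s t :
      tcongr (tScale a (tAdd s t)) (tAdd (tScale a s) (tScale a t))
  | tc_scaleDl a b t :
      tcongr (tScale (a + b) t) (tAdd (tScale a t) (tScale b t))
  | tc_mulA s t u : tcongr (tMul s (tMul t u)) (tMul (tMul s t) u)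
  | tc_mul1l t : tcongr (tMul tOne t) t
  | tc_mul1r t : tcongr (tMul t tOne) t
  | tc_mulDl s t u : tcongr (tMul (tAdd s t) u) (tAdd (tMul s u) (tMul t u))
  | tc_mulDr s t u : tcongr (tMul s (tAdd t u)) (tAdd (tMul s t) (tMul s u))
  | tc_scaleAl a s t : tcongr (tScale a (tMul s t)) (tMul (tScale a s) t)
  | tc_scaleAr a s t : tcongr (tScale a (tMul s t)) (tMul s (tScale a t)).

HB.instance Definition _ := gen_eqMixin term.
HB.instance Definition _ := gen_choiceMixin term.

Definition tcongrb s t := `[< tcongr s t >].

Lemma tcongrb_refl : reflexive tcongrb.
Proof. by move=> t; apply/asboolP; exact: tc_refl. Qed.
Lemma tcongrb_sym : symmetric tcongrb.
Proof. by move=> s t; apply/asboolP/asboolP; exact: tc_sym. Qed.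
Lemma tcongrb_trans : transitive tcongrb.
Proof.
by move=> t s u /asboolP st /asboolP tu; apply/asboolP; exact: tc_trans st tu.
Qed.

Canonical tcongr_equiv :=
  EquivRel tcongrb tcongrb_refl tcongrb_sym tcongrb_trans.

Definition presAlg := {eq_quot tcongr_equiv}.
HB.instance Definition _ := Choice.on presAlg.

Definition pcl (t : term) : presAlg := \pi_presAlg t.

Lemma pclP s t : pcl s = pcl t <-> tcongr s t.
Proof. by split=> [/eqmodP/asboolP //|st]; apply/eqmodP/asboolP. Qed.

Lemma pcl_repr (x : presAlg) : pcl (repr x) = x.
Proof. exact: reprK. Qed.

Lemma repr_pcl t : tcongr (repr (pcl t)) t.
Proof. by apply/pclP; rewrite pcl_repr. Qed.

Lemma pclW (P : presAlg -> Prop) : (forall t, P (pcl t)) -> forall x, P x.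
Proof. by move=> Pt x; rewrite -(pcl_repr x). Qed.

Definition padd (x y : presAlg) := pcl (tAdd (repr x) (repr y)).
Definition pmul (x y : presAlg) := pcl (tMul (repr x) (repr y)).
Definition pscale (a : k) (x : presAlg) := pcl (tScale a (repr x)).
Definition popp (x : presAlg) := pscale (-1) x.

Lemma paddE s t : padd (pcl s) (pcl t) = pcl (tAdd s t).
Proof. by apply/pclP/tc_add; exact: repr_pcl. Qed.
Lemma pmulE s t : pmul (pcl s) (pcl t) = pcl (tMul s t).
Proof. by apply/pclP/tc_mul; exact: repr_pcl. Qed.
Lemma pscaleE a t : pscale a (pcl t) = pcl (tScale a t).
Proof. by apply/pclP/tc_scale; exact: repr_pcl. Qed.

Fact paddA : associative padd.
Proof.
elim/pclW=> s; elim/pclW=> t; elim/pclW=> u; rewrite !paddE.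
by apply/pclP; constructor.
Qed.
Fact paddC : commutative padd.
Proof. by elim/pclW=> s; elim/pclW=> t; rewrite !paddE; apply/pclP; constructor. Qed.
Fact padd0 : left_id (pcl tZero) padd.
Proof. by elim/pclW=> s; rewrite !paddE; apply/pclP; constructor. Qed.
Fact paddN : left_inverse (pcl tZero) popp padd.
Proof.
elim/pclW=> s; rewrite /popp pscaleE paddE; apply/pclP.
apply: tc_trans (tc_scale0 s); rewrite -(addNr 1); apply: tc_sym.
apply: tc_trans (tc_scaleDl _ _ _) _.
by apply: tc_add; [exact: tc_refl | exact: tc_scale1].
Qed.

HB.instance Definition _ := GRing.isZmodule.Build presAlg paddA paddC padd0 paddN.

Fact pscaleA a b x : pscale a (pscale b x) = pscale (a * b) x.
Proof. by elim/pclW: x => s; rewrite !pscaleE; apply/pclP; constructor. Qed.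
Fact pscale1 : left_id 1 pscale.
Proof. by elim/pclW=> s; rewrite !pscaleE; apply/pclP; constructor. Qed.
Fact pscaleDr : right_distributive pscale +%R.
Proof.
move=> a; elim/pclW=> s; elim/pclW=> t; rewrite /GRing.add /=.
by rewrite !(paddE, pscaleE); apply/pclP; constructor.
Qed.
Fact pscaleDl x : {morph pscale^~ x : a b / a + b}.
Proof.
move=> a b; elim/pclW: x => s; rewrite {2}/GRing.add /=.
by rewrite !(paddE, pscaleE); apply/pclP; constructor.
Qed.

HB.instance Definition _ :=
  GRing.Zmodule_isLmodule.Build k presAlg pscaleA pscale1 pscaleDr pscaleDl.

Fact pmulA : associative pmul.
Proof.
elim/pclW=> s; elim/pclW=> t; elim/pclW=> u; rewrite !pmulE.
by apply/pclP; constructor.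
Qed.
Fact pmul1l : left_id (pcl tOne) pmul.
Proof. by elim/pclW=> s; rewrite !pmulE; apply/pclP; constructor. Qed.
Fact pmul1r : right_id (pcl tOne) pmul.
Proof. by elim/pclW=> s; rewrite !pmulE; apply/pclP; constructor. Qed.
Fact pmulDl : left_distributive pmul +%R.
Proof.
elim/pclW=> s; elim/pclW=> t; elim/pclW=> u; rewrite /GRing.add /=.
by rewrite !(pmulE, paddE); apply/pclP; constructor.
Qed.
Fact pmulDr : right_distributive pmul +%R.
Proof.
elim/pclW=> s; elim/pclW=> t; elim/pclW=> u; rewrite /GRing.add /=.
by rewrite !(pmulE, paddE); apply/pclP; constructor.
Qed.

HB.instance Definition _ :=
  GRing.Zmodule_isPzRing.Build presAlg pmulA pmul1l pmul1r pmulDl pmulDr.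

Lemma pscaleAl a (x y : presAlg) : a *: (x * y) = (a *: x) * y.
Proof.
elim/pclW: x => s; elim/pclW: y => t; rewrite /GRing.scale /GRing.mul /=.
by rewrite !(pmulE, pscaleE); apply/pclP; constructor.
Qed.
Lemma pscaleAr a (x y : presAlg) : a *: (x * y) = x * (a *: y).
Proof.
elim/pclW: x => s; elim/pclW: y => t; rewrite /GRing.scale /GRing.mul /=.
by rewrite !(pmulE, pscaleE); apply/pclP; constructor.
Qed.

Definition pgen (x : G) : presAlg := pcl (tGen x).

Lemma pcl0 : pcl tZero = 0. Proof. by []. Qed.
Lemma pcl1 : pcl tOne = 1. Proof. by []. Qed.
Lemma pclD s t : pcl (tAdd s t) = pcl s + pcl t.
Proof. by rewrite -paddE. Qed.
Lemma pclM s t : pcl (tMul s t) = pcl s * pcl t.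
Proof. by rewrite -pmulE. Qed.
Lemma pclZ a t : pcl (tScale a t) = a *: pcl t.
Proof. by rewrite -pscaleE. Qed.
Lemma pclB s t : pcl (tSub s t) = pcl s - pcl t.
Proof. by rewrite pclD pclZ scaleN1r. Qed.
Lemma pclX t n : pcl (tExp t n) = pcl t ^+ n.
Proof. by elim: n => [|n IHn] //; rewrite exprS -IHn -pclM. Qed.

Lemma presAlg_ind (P : presAlg -> Prop) :
    (forall x, P (pgen x)) -> P 0 -> P 1 ->
    (forall x y, P x -> P y -> P (x + y)) ->
    (forall x y, P x -> P y -> P (x * y)) ->
    (forall a x, P x -> P (a *: x)) ->
  forall x, P x.
Proof.
move=> Pg P0 P1 PD PM PZ; elim/pclW.
elim=> [x|||s Ps t Pt|s Ps t Pt|a s Ps] //.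
- exact: Pg.
- by rewrite pclD; exact: PD.
- by rewrite pclM; exact: PM.
- by rewrite pclZ; exact: PZ.
Qed.

Section Eval.
Variables (A : algType k) (f : G -> A).

Fixpoint teval (t : term) : A :=
  match t with
  | tGen x => f x
  | tZero => 0
  | tOne => 1
  | tAdd s t => teval s + teval t
  | tMul s t => teval s * teval t
  | tScale a t => a *: teval t
  end.

(* The algebra map extending f; meaningful when f respects the relations.     *)
Definition plift (x : presAlg) : A := teval (repr x).

Lemma tevalB s t : teval (tSub s t) = teval s - teval t.
Proof. by rewrite /= scaleN1r. Qed.
Lemma tevalX t n : teval (tExp t n) = teval t ^+ n.
Proof. by elim: n => [|n IHn] //=; rewrite exprS -IHn. Qed.

Hypothesis f_rel : forall s t, rel s t -> teval s = teval t.

Lemma teval_congr s t : tcongr s t -> teval s = teval t.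
Proof.
elim=> //= {s t}.
- by move=> s t u _ -> _ ->.
- by move=> s s' t t' _ -> _ ->.
- by move=> s s' t t' _ -> _ ->.
- by move=> a s s' _ ->.
- by move=> s t u; rewrite addrA.
- by move=> s t; rewrite addrC.
- by move=> t; rewrite add0r.
- by move=> t; rewrite scale0r.
- by move=> t; rewrite scale1r.
- by move=> a b t; rewrite scalerA.
- by move=> a s t; rewrite scalerDr.
- by move=> a b t; rewrite scalerDl.
- by move=> s t u; rewrite mulrA.
- by move=> t; rewrite mul1r.
- by move=> t; rewrite mulr1.
- by move=> s t u; rewrite mulrDl.
- by move=> s t u; rewrite mulrDr.
- by move=> a s t; rewrite scalerAl.
- by move=> a s t; rewrite scalerAr.
Qed.

Lemma plift_pcl t : plift (pcl t) = teval t.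
Proof. by apply: teval_congr; exact: repr_pcl. Qed.
Lemma plift_gen x : plift (pgen x) = f x.
Proof. exact: plift_pcl. Qed.
Lemma plift1 : plift 1 = 1.
Proof. exact: plift_pcl. Qed.
Lemma pliftM x y : plift (x * y) = plift x * plift y.
Proof. by elim/pclW: x => s; elim/pclW: y => t; rewrite -pclM !plift_pcl. Qed.
Lemma plift_linear : linear plift.
Proof.
move=> a; elim/pclW=> s; elim/pclW=> t.
by rewrite -pclZ -pclD !plift_pcl.
Qed.

End Eval.
End Presentation.

(* The tensor product of two k-vector spaces: formal linear combinations of   *)
(* symbols v (x) w modulo bilinearity.                                        *)
Section Tensor.
Variables (k : fieldType) (V W : lmodType k).

Inductive mterm :=
  | mPure of V & W
  | mZero
  | mAdd of mterm & mterm
  | mScale of k & mterm.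

Inductive mcongr : mterm -> mterm -> Prop :=
  | mc_pureDl a v v' w :
      mcongr (mPure (a *: v + v') w) (mAdd (mScale a (mPure v w)) (mPure v' w))
  | mc_pureDr a v w w' :
      mcongr (mPure v (a *: w + w')) (mAdd (mScale a (mPure v w)) (mPure v w'))
  | mc_refl t : mcongr t t
  | mc_sym s t : mcongr s t -> mcongr t s
  | mc_trans s t u : mcongr s t -> mcongr t u -> mcongr s u
  | mc_add s s' t t' :
      mcongr s s' -> mcongr t t' -> mcongr (mAdd s t) (mAdd s' t')
  | mc_scale a s s' : mcongr s s' -> mcongr (mScale a s) (mScale a s')
  | mc_addA s t u : mcongr (mAdd s (mAdd t u)) (mAdd (mAdd s t) u)
  | mc_addC s t : mcongr (mAdd s t) (mAdd t s)
  | mc_add0 t : mcongr (mAdd mZero t) t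
  | mc_scale0 t : mcongr (mScale 0 t) mZero
  | mc_scale1 t : mcongr (mScale 1 t) t
  | mc_scaleA a b t : mcongr (mScale a (mScale b t)) (mScale (a * b) t)
  | mc_scaleDr a s t :
      mcongr (mScale a (mAdd s t)) (mAdd (mScale a s) (mScale a t))
  | mc_scaleDl a b t :
      mcongr (mScale (a + b) t) (mAdd (mScale a t) (mScale b t)).

HB.instance Definition _ := gen_eqMixin mterm.
HB.instance Definition _ := gen_choiceMixin mterm.

Definition mcongrb s t := `[< mcongr s t >].

Lemma mcongrb_refl : reflexive mcongrb.
Proof. by move=> t; apply/asboolP; exact: mc_refl. Qed.
Lemma mcongrb_sym : symmetric mcongrb.
Proof. by move=> s t; apply/asboolP/asboolP; exact: mc_sym. Qed.
Lemma mcongrb_trans : transitive mcongrb.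
Proof.
by move=> t s u /asboolP st /asboolP tu; apply/asboolP; exact: mc_trans st tu.
Qed.

Canonical mcongr_equiv :=
  EquivRel mcongrb mcongrb_refl mcongrb_sym mcongrb_trans.

Definition tensor := {eq_quot mcongr_equiv}.
HB.instance Definition _ := Choice.on tensor.

Definition mcl (t : mterm) : tensor := \pi_tensor t.

Lemma mclP s t : mcl s = mcl t <-> mcongr s t.
Proof. by split=> [/eqmodP/asboolP //|st]; apply/eqmodP/asboolP. Qed.

Lemma mcl_repr (x : tensor) : mcl (repr x) = x.
Proof. exact: reprK. Qed.

Lemma repr_mcl t : mcongr (repr (mcl t)) t.
Proof. by apply/mclP; rewrite mcl_repr. Qed.

Lemma mclW (P : tensor -> Prop) : (forall t, P (mcl t)) -> forall x, P x.
Proof. by move=> Pt x; rewrite -(mcl_repr x). Qed.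

Definition madd (x y : tensor) := mcl (mAdd (repr x) (repr y)).
Definition mscale (a : k) (x : tensor) := mcl (mScale a (repr x)).
Definition mopp (x : tensor) := mscale (-1) x.

Lemma maddE s t : madd (mcl s) (mcl t) = mcl (mAdd s t).
Proof. by apply/mclP/mc_add; exact: repr_mcl. Qed.
Lemma mscaleE a t : mscale a (mcl t) = mcl (mScale a t).
Proof. by apply/mclP/mc_scale; exact: repr_mcl. Qed.

Fact maddA : associative madd.
Proof.
elim/mclW=> s; elim/mclW=> t; elim/mclW=> u; rewrite !maddE.
by apply/mclP; constructor.
Qed.
Fact maddC : commutative madd.
Proof. by elim/mclW=> s; elim/mclW=> t; rewrite !maddE; apply/mclP; constructor. Qed.
Fact madd0 : left_id (mcl mZero) madd.
Proof. by elim/mclW=> s; rewrite !maddE; apply/mclP; constructor. Qed.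
Fact maddN : left_inverse (mcl mZero) mopp madd.
Proof.
elim/mclW=> s; rewrite /mopp mscaleE maddE; apply/mclP.
apply: mc_trans (mc_scale0 s); rewrite -(addNr 1); apply: mc_sym.
apply: mc_trans (mc_scaleDl _ _ _) _.
by apply: mc_add; [exact: mc_refl | exact: mc_scale1].
Qed.

HB.instance Definition _ := GRing.isZmodule.Build tensor maddA maddC madd0 maddN.

Fact mscaleA a b x : mscale a (mscale b x) = mscale (a * b) x.
Proof. by elim/mclW: x => s; rewrite !mscaleE; apply/mclP; constructor. Qed.
Fact mscale1 : left_id 1 mscale.
Proof. by elim/mclW=> s; rewrite !mscaleE; apply/mclP; constructor. Qed.
Fact mscaleDr : right_distributive mscale +%R.
Proof.
move=> a; elim/mclW=> s; elim/mclW=> t; rewrite /GRing.add /=.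
by rewrite !(maddE, mscaleE); apply/mclP; constructor.
Qed.
Fact mscaleDl x : {morph mscale^~ x : a b / a + b}.
Proof.
move=> a b; elim/mclW: x => s; rewrite {2}/GRing.add /=.
by rewrite !(maddE, mscaleE); apply/mclP; constructor.
Qed.

HB.instance Definition _ :=
  GRing.Zmodule_isLmodule.Build k tensor mscaleA mscale1 mscaleDr mscaleDl.

Definition tpure (v : V) (w : W) : tensor := mcl (mPure v w).

Lemma mclD s t : mcl (mAdd s t) = mcl s + mcl t.
Proof. by rewrite -maddE. Qed.
Lemma mclZ a t : mcl (mScale a t) = a *: mcl t.
Proof. by rewrite -mscaleE. Qed.

Lemma tpure_linearl w : linear (tpure^~ w).
Proof. by move=> a v v'; rewrite -mclZ -mclD; apply/mclP; constructor. Qed.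
Lemma tpure_linearr v : linear (tpure v).
Proof. by move=> a w w'; rewrite -mclZ -mclD; apply/mclP; constructor. Qed.

Lemma tensor_ind (P : tensor -> Prop) :
    (forall v w, P (tpure v w)) -> P 0 ->
    (forall x y, P x -> P y -> P (x + y)) ->
    (forall a x, P x -> P (a *: x)) ->
  forall x, P x.
Proof.
move=> Pp P0 PD PZ; elim/mclW; elim=> [v w||s Ps t Pt|a s Ps] //.
- exact: Pp.
- by rewrite mclD; exact: PD.
- by rewrite mclZ; exact: PZ.
Qed.

Section Lift.
Variables (X : lmodType k) (f : V -> W -> X).

Fixpoint meval (t : mterm) : X :=
  match t with
  | mPure v w => f v w
  | mZero => 0
  | mAdd s t => meval s + meval t
  | mScale a t => a *: meval t
  end.

(* The linear map with v (x) w |-> f v w; meaningful when f is bilinear.      *)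
Definition tlift (x : tensor) : X := meval (repr x).

Hypotheses (f_linl : forall w, linear (f^~ w)) (f_linr : forall v, linear (f v)).

Lemma meval_congr s t : mcongr s t -> meval s = meval t.
Proof.
elim=> //= {s t}.
- by move=> a v v' w; exact: f_linl.
- by move=> a v w w'; exact: f_linr.
- by move=> s t u _ -> _ ->.
- by move=> s s' t t' _ -> _ ->.
- by move=> a s s' _ ->.
- by move=> s t u; rewrite addrA.
- by move=> s t; rewrite addrC.
- by move=> t; rewrite add0r.
- by move=> t; rewrite scale0r.
- by move=> t; rewrite scale1r.
- by move=> a b t; rewrite scalerA.
- by move=> a s t; rewrite scalerDr.
- by move=> a b t; rewrite scalerDl.
Qed.

Lemma tlift_mcl t : tlift (mcl t) = meval t.
Proof. by apply: meval_congr; exact: repr_mcl. Qed.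
Lemma tlift_pure v w : tlift (tpure v w) = f v w.
Proof. exact: tlift_mcl. Qed.
Lemma tlift_linear : linear tlift.
Proof.
move=> a; elim/mclW=> s; elim/mclW=> t.
by rewrite -mclZ -mclD !tlift_mcl.
Qed.

End Lift.
End Tensor.

Section LinearFacts.
Variables (k : fieldType) (V W : lmodType k) (f : V -> W).
Hypothesis f_lin : linear f.
Lemma lin0 : f 0 = 0.
Proof. by have := f_lin (-1) 0 0; rewrite scaler0 addr0 scaleN1r addNr. Qed.
Lemma linD x y : f (x + y) = f x + f y.
Proof. by have := f_lin 1 x y; rewrite !scale1r. Qed.
Lemma linZ a x : f (a *: x) = a *: f x.
Proof. by have := f_lin a x 0; rewrite !addr0 lin0 addr0. Qed.
End LinearFacts.

(* The tensor product of algebras, with (a (x) b)(a' (x) b') = aa' (x) bb'.   *)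
Section TensorAlgebra.
Variables (k : fieldType) (A B : algType k).
Local Notation AB := (tensor A B).

Definition tmul (x y : AB) : AB :=
  tlift (fun a b => tlift (fun a' b' => tpure (a * a') (b * b')) y) x.

Fact tmul_in_linl a b b' : linear (fun a' => tpure (a * a') (b * b') : AB).
Proof. by move=> c x y /=; rewrite mulrDr -scalerAr tpure_linearl. Qed.
Fact tmul_in_linr a b a' : linear (fun b' => tpure (a * a') (b * b') : AB).
Proof. by move=> c x y /=; rewrite mulrDr -scalerAr tpure_linearr. Qed.
Fact tmul_in_lin a b :
  linear (fun y : AB => tlift (fun a' b' => tpure (a * a') (b * b') : AB) y).
Proof.
by apply: tlift_linear => ?; [exact: tmul_in_linl | exact: tmul_in_linr].
Qed.
Fact tmul_inE a b a' b' :
  tlift (fun a' b' => tpure (a * a') (b * b') : AB) (tpure a' b')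
  = tpure (a * a') (b * b').
Proof.
by apply: tlift_pure => ?; [exact: tmul_in_linl | exact: tmul_in_linr].
Qed.

Fact tmul_out_linl y b :
  linear (fun a => tlift (fun a' b' => tpure (a * a') (b * b') : AB) y).
Proof.
move=> c u v; elim/tensor_ind: y => [a' b'||x y IHx IHy|d x IHx].
- by rewrite !tmul_inE mulrDl -scalerAl tpure_linearl.
- by rewrite !(lin0 (tmul_in_lin _ _)) scaler0 addr0.
- by rewrite !(linD (tmul_in_lin _ _)) IHx IHy scalerDr addrACA.
- by rewrite !(linZ (tmul_in_lin _ _)) IHx scalerDr !scalerA mulrC.
Qed.
Fact tmul_out_linr y a :
  linear (fun b => tlift (fun a' b' => tpure (a * a') (b * b') : AB) y).
Proof.
move=> c u v; elim/tensor_ind: y => [a' b'||x y IHx IHy|d x IHx].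
- by rewrite !tmul_inE mulrDl -scalerAl tpure_linearr.
- by rewrite !(lin0 (tmul_in_lin _ _)) scaler0 addr0.
- by rewrite !(linD (tmul_in_lin _ _)) IHx IHy scalerDr addrACA.
- by rewrite !(linZ (tmul_in_lin _ _)) IHx scalerDr !scalerA mulrC.
Qed.

Lemma tmul_linl y : linear (tmul^~ y).
Proof.
by apply: tlift_linear => ?; [exact: tmul_out_linl | exact: tmul_out_linr].
Qed.
Lemma tmul_pureE a b y :
  tmul (tpure a b) y = tlift (fun a' b' => tpure (a * a') (b * b')) y.
Proof.
apply: (tlift_pure
  (f := fun a b => tlift (fun a' b' => tpure (a * a') (b * b') : AB) y)) => ?.
  exact: tmul_out_linl.
exact: tmul_out_linr.
Qed.
Lemma tmul_pure a b a' b' :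
  tmul (tpure a b) (tpure a' b') = tpure (a * a') (b * b').
Proof. by rewrite tmul_pureE tmul_inE. Qed.
Lemma tmul_linr x : linear (tmul x).
Proof.
move=> c u v; elim/tensor_ind: x => [a b||x y IHx IHy|d x IHx].
- by rewrite !tmul_pureE tmul_in_lin.
- by rewrite !(lin0 (tmul_linl _)) scaler0 addr0.
- by rewrite !(linD (tmul_linl _)) IHx IHy scalerDr addrACA.
- by rewrite !(linZ (tmul_linl _)) IHx scalerDr !scalerA mulrC.
Qed.

Fact tmulA : associative tmul.
Proof.
elim/tensor_ind => [a b||x y IHx IHy|d x IHx] y1 z.
- elim/tensor_ind: y1 => [a1 b1||x y IHx IHy|d x IHx].
  + elim/tensor_ind: z => [a2 b2||x y IHx IHy|d x IHx].
    * by rewrite !tmul_pure !mulrA.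
    * by rewrite !(lin0 (tmul_linr _)).
    * by rewrite !(linD (tmul_linr _)) IHx IHy.
    * by rewrite !(linZ (tmul_linr _)) IHx.
  + by rewrite !(lin0 (tmul_linr _), lin0 (tmul_linl _)).
  + by rewrite !(linD (tmul_linr _), linD (tmul_linl _)) IHx IHy.
  + by rewrite !(linZ (tmul_linr _), linZ (tmul_linl _)) IHx.
- by rewrite !(lin0 (tmul_linl _)).
- by rewrite !(linD (tmul_linl _)) IHx IHy.
- by rewrite !(linZ (tmul_linl _)) IHx.
Qed.
Fact tmul1l : left_id (tpure 1 1) tmul.
Proof.
elim/tensor_ind => [a b||x y IHx IHy|d x IHx].
- by rewrite tmul_pure !mul1r.
- by rewrite (lin0 (tmul_linr _)).
- by rewrite (linD (tmul_linr _)) IHx IHy.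
- by rewrite (linZ (tmul_linr _)) IHx.
Qed.
Fact tmul1r : right_id (tpure 1 1) tmul.
Proof.
elim/tensor_ind => [a b||x y IHx IHy|d x IHx].
- by rewrite tmul_pure !mulr1.
- by rewrite (lin0 (tmul_linl _)).
- by rewrite (linD (tmul_linl _)) IHx IHy.
- by rewrite (linZ (tmul_linl _)) IHx.
Qed.
Fact tmulDl : left_distributive tmul +%R.
Proof. by move=> x y z; exact: (linD (tmul_linl z)). Qed.
Fact tmulDr : right_distributive tmul +%R.
Proof. by move=> x y z; exact: (linD (tmul_linr x)). Qed.

HB.instance Definition _ :=
  GRing.Zmodule_isPzRing.Build AB tmulA tmul1l tmul1r tmulDl tmulDr.

Lemma tensor_mulE a b a' b' :
  tpure a b * tpure a' b' = tpure (a * a') (b * b') :> AB.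
Proof. exact: tmul_pure. Qed.
Lemma tensor_1E : tpure 1 1 = 1 :> AB. Proof. by []. Qed.
Lemma tensor_expE a b n : tpure a b ^+ n = tpure (a ^+ n) (b ^+ n) :> AB.
Proof. by elim: n => [|n IHn] //; rewrite !exprS IHn tensor_mulE. Qed.
Lemma tensor_scaleAl a (x y : AB) : a *: (x * y) = (a *: x) * y.
Proof. by rewrite [RHS](linZ (tmul_linl y)). Qed.
Lemma tensor_scaleAr a (x y : AB) : a *: (x * y) = x * (a *: y).
Proof. by rewrite [RHS](linZ (tmul_linr x)). Qed.

End TensorAlgebra.

(* The opposite algebra, on the library's opposite ring A^c.                  *)
Section OppositeAlgebra.
Variables (k : fieldType) (A : algType k).

HB.instance Definition _ := GRing.LSemiModule.copy A^c A.
Fact opp_scaleAl (a : k) (x y : A^c) :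
  a *: (x * y) = (a *: x : A^c) * y :> A^c.
Proof. exact: (scalerAr a (y : A) (x : A)). Qed.
HB.instance Definition _ :=
  GRing.LSemiModule_isLSemiAlgebra.Build k A^c opp_scaleAl.
Fact opp_scaleAr (a : k) (x y : A^c) :
  a *: (x * y) = x * (a *: y : A^c) :> A^c.
Proof. exact: (scalerAl a (y : A) (x : A)). Qed.
HB.instance Definition _ :=
  GRing.LSemiAlgebra_isSemiAlgebra.Build k A^c opp_scaleAr.
End OppositeAlgebra.


(* f (x) g; meaningful when f and g are linear.                               *)
Definition tmap (k : fieldType) (V W V' W' : lmodType k)
    (f : V -> V') (g : W -> W') : tensor V W -> tensor V' W' :=
  tlift (fun v w => tpure (f v) (g w)).

Section TensorPower.
Variables (k : fieldType) (V : lmodType k).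

(* The tensor power of V with n.+1 factors, associated to the right.          *)
Fixpoint tpow (n : nat) : lmodType k :=
  if n is n'.+1 then tensor V (tpow n') else V.

(* v 0 (x) ... (x) v n *)
Fixpoint tpures (n : nat) : ('I_n.+1 -> V) -> tpow n :=
  match n with
  | 0 => fun v => v ord0
  | n'.+1 => fun v => tpure (v ord0) (tpures (fun i => v (lift ord0 i)))
  end.
End TensorPower.

Section QBinomial.
Variables (k : fieldType) (q : k).

Fixpoint qbin (n i : nat) : k :=
  match n, i with
  | _, 0 => 1
  | 0, _.+1 => 0
  | n'.+1, i'.+1 => qbin n' i' + q ^+ i * qbin n' i
  end.

Lemma qbin0 n : qbin n 0 = 1. Proof. by case: n. Qed.
Lemma qbinS n i : qbin n.+1 i.+1 = qbin n i + q ^+ i.+1 * qbin n i.+1.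
Proof. by []. Qed.
Lemma qbin_small n i : (n < i)%N -> qbin n i = 0.
Proof.
elim: n i => [|n IHn] [|i] //; rewrite ltnS => ni.
by rewrite qbinS !IHn ?mulr0 ?addr0 // ltnW.
Qed.

Lemma qbin_absorb n i :
  (1 - q ^+ i.+1) * qbin n.+1 i.+1 = (1 - q ^+ n.+1) * qbin n i.
Proof.
elim: n i => [|n IHn] [|i].
- by rewrite qbinS /= mulr0 addr0.
- by rewrite qbinS /= !mulr0 addr0 mulr0.
- rewrite qbinS mulrDr mulrCA IHn !qbin0 !exprS expr0.
  by ring.
- have Hq : q ^+ i.+1 * qbin n i.+1 = qbin n.+1 i.+1 - qbin n i.
    by rewrite qbinS; ring.
  rewrite qbinS mulrDr mulrCA IHn.
  have -> : q ^+ i.+2 * ((1 - q ^+ n.+1) * qbin n i.+1)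
          = q * ((1 - q ^+ n.+1) * (q ^+ i.+1 * qbin n i.+1)).
    by rewrite [q ^+ i.+2]exprS; ring.
  rewrite Hq [_ * (_ - qbin n i)]mulrBr -IHn.
  by rewrite [q ^+ i.+2]exprS [q ^+ n.+2]exprS; ring.
Qed.

Lemma qbin_prim n i : n.-primitive_root q -> (0 < i < n)%N -> qbin n i = 0.
Proof.
case: n i => [|n] [|i] // qn /andP[_ lt_in].
have := qbin_absorb n i; rewrite (prim_expr_order qn) subrr mul0r => /eqP.
rewrite mulf_eq0 => /orP[|/eqP //]; rewrite subr_eq0 eq_sym.
rewrite -(prim_order_dvd qn) => /dvdn_leq /= /(_ isT).
by rewrite leqNgt lt_in.
Qed.

Variables (A : algType k) (x y : A).
Hypothesis yx : y * x = q *: (x * y).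

Lemma qcomm_expr i : y * x ^+ i = q ^+ i *: (x ^+ i * y).
Proof.
elim: i => [|i IHi]; first by rewrite !expr0 mulr1 mul1r scale1r.
rewrite exprSr mulrA IHi -scalerAl -[x ^+ i * y * x]mulrA yx -scalerAr scalerA.
by rewrite mulrA -!exprSr.
Qed.

Lemma qbinomial n :
  (x + y) ^+ n = \sum_(i < n.+1) qbin n i *: (x ^+ i * y ^+ (n - i)).
Proof.
elim: n => [|n IHn]; first by rewrite big_ord1 scale1r mulr1.
rewrite exprS IHn mulrDl !mulr_sumr [in RHS]big_ord_recl /=.
have -> : \sum_(i < n.+1) y * (qbin n i *: (x ^+ i * y ^+ (n - i)))
        = y ^+ n.+1 + \sum_(i < n.+1)
            (q ^+ i.+1 * qbin n i.+1) *: (x ^+ i.+1 * y ^+ (n - i)).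
  rewrite big_ord_recl [in RHS]big_ord_recr /= qbin0 expr0 scale1r mul1r -exprS.
  rewrite subn0 (qbin_small (ltnSn n)) mulr0 scale0r addr0; congr (_ + _).
  apply: eq_bigr => i _ /=; rewrite /bump /= add1n.
  rewrite -scalerAr mulrA qcomm_expr -scalerAl scalerA -mulrA -exprS mulrC.
  by rewrite subnSK.
rewrite expr0 scale1r mul1r subn0 addrCA -big_split /=; congr (_ + _).
apply: eq_bigr => i _; rewrite /bump /= add1n subSS scalerDl.
by rewrite -scalerAr mulrA -exprS.
Qed.

Lemma qbinomial_prim n :
    n.-primitive_root q -> x ^+ n = 0 -> y ^+ n = 0 -> (x + y) ^+ n = 0.
Proof.
move=> qn xn yn; rewrite qbinomial big1 // => i _.
have [->|i_gt0] := posnP i; first by rewrite subn0 yn mulr0 scaler0.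
have := ltn_ord i; rewrite ltnS leq_eqVlt => /orP[/eqP ->|lt_in].
  by rewrite xn mul0r scaler0.
by rewrite qbin_prim ?scale0r // i_gt0.
Qed.

Lemma qcomm_exprM n : exists c, (x * y) ^+ n = c *: (x ^+ n * y ^+ n).
Proof.
elim: n => [|n [c IHn]]; first by exists 1; rewrite !expr0 mulr1 scale1r.
exists (c * q ^+ n).
rewrite exprSr IHn -scalerAl -[x ^+ n * y ^+ n * _]mulrA (mulrA (y ^+ n)).
have -> : y ^+ n * x = q ^+ n *: (x * y ^+ n).
  elim: n {IHn} => [|n IHn]; first by rewrite !expr0 mulr1 mul1r scale1r.
  rewrite exprSr -mulrA yx -scalerAr (mulrA (y ^+ n) x) IHn -scalerAl scalerA.
  by rewrite -exprS -mulrA.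
by rewrite -scalerAl -scalerAr scalerA -[x * _ * y]mulrA -exprSr mulrA -exprSr.
Qed.

End QBinomial.

Variant ugen := GenE | GenF | GenK.

Section SmallQuantumGroup.
Variables (k : fieldType) (r : nat) (z : k).

Let tE : term k ugen := tGen k GenE.
Let tF : term k ugen := tGen k GenF.
Let tK : term k ugen := tGen k GenK.
(* K^-1 is K^(r-1), as K^r = 1. *)
Let tKinv : term k ugen := tExp tK r.-1.

(* r.-1.+1 is r for r > 0; it keeps the algebra nonzero for r = 0.            *)
Variant urel : term k ugen -> term k ugen -> Prop :=
  | urelE : urel (tExp tE r.-1.+1) (tZero k ugen)
  | urelF : urel (tExp tF r.-1.+1) (tZero k ugen)
  | urelK : urel (tExp tK r.-1.+1) (tOne k ugen)
  | urelKE : urel (tMul (tMul tK tE) tKinv) (tScale (z ^+ 2) tE)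
  | urelKF : urel (tMul (tMul tK tF) tKinv) (tScale (z ^- 2) tF)
  | urelEF : urel (tSub (tMul tE tF) (tMul tF tE)) (tSub tK tKinv).

Definition uzeta := presAlg urel.
HB.instance Definition _ := GRing.PzRing.on uzeta.
HB.instance Definition _ := GRing.Lmodule.on uzeta.

Definition counit : uzeta -> k^o :=
  plift (fun x => if x is GenK then 1 else 0).

Fact counit_rel s t : urel s t ->
  teval (fun x => if x is GenK then 1 else 0 : k^o) s
  = teval (fun x => if x is GenK then 1 else 0 : k^o) t.
Proof.
case; rewrite ?tevalB ?tevalX /= ?tevalX /= ?expr1n //.
- by rewrite exprS mul0r.
- by rewrite exprS mul0r.
- by rewrite mulr1 mulr0 scaler0.
- by rewrite mulr1 mulr0 scaler0.
- by rewrite mulr0 !subrr.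
Qed.

Lemma counit1 : counit 1 = 1. Proof. exact: plift1 counit_rel. Qed.
Lemma counit_linear : linear counit. Proof. exact: plift_linear counit_rel. Qed.

Fact uzeta_neq0 : (1 : uzeta) != 0.
Proof.
apply/eqP => /(congr1 counit); rewrite counit1 (lin0 counit_linear).
by move/eqP; rewrite oner_eq0.
Qed.

HB.instance Definition _ := GRing.PzSemiRing_isNonZero.Build uzeta uzeta_neq0.
HB.instance Definition _ :=
  GRing.LSemiModule_isLSemiAlgebra.Build k uzeta (@pscaleAl k ugen urel).
HB.instance Definition _ :=
  GRing.LSemiAlgebra_isSemiAlgebra.Build k uzeta (@pscaleAr k ugen urel).

Definition uE : uzeta := pgen urel GenE.
Definition uF : uzeta := pgen urel GenF.
Definition uK : uzeta := pgen urel GenK.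
Definition uKinv : uzeta := uK ^+ r.-1.

Lemma uE_exp : uE ^+ r.-1.+1 = 0.
Proof. by rewrite -pclX; apply/pclP/tc_rel; constructor. Qed.
Lemma uF_exp : uF ^+ r.-1.+1 = 0.
Proof. by rewrite -pclX; apply/pclP/tc_rel; constructor. Qed.
Lemma uK_exp : uK ^+ r.-1.+1 = 1.
Proof. by rewrite -pclX; apply/pclP/tc_rel; constructor. Qed.
Lemma uKEKinv : uK * uE * uKinv = z ^+ 2 *: uE.
Proof. by have /pclP := tc_rel urelKE; rewrite !pclM pclX pclZ. Qed.
Lemma uKFKinv : uK * uF * uKinv = z ^- 2 *: uF.
Proof. by have /pclP := tc_rel urelKF; rewrite !pclM pclX pclZ. Qed.
Lemma uEF_comm : uE * uF - uF * uE = uK - uKinv.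
Proof. by have /pclP := tc_rel urelEF; rewrite !pclB !pclM pclX. Qed.

Lemma uKKinv : uK * uKinv = 1.
Proof. by rewrite -exprS uK_exp. Qed.
Lemma uKinvK : uKinv * uK = 1.
Proof. by rewrite -exprSr uK_exp. Qed.
Lemma uKE : uK * uE = z ^+ 2 *: (uE * uK).
Proof.
by have /(congr1 (fun x => x * uK)) := uKEKinv;
  rewrite -mulrA uKinvK mulr1 -scalerAl.
Qed.
Lemma uKF : uK * uF = z ^- 2 *: (uF * uK).
Proof.
by have /(congr1 (fun x => x * uK)) := uKFKinv;
  rewrite -mulrA uKinvK mulr1 -scalerAl.
Qed.

Local Notation UU := (tensor uzeta uzeta).

Definition counit2 : UU -> k^o := tlift (fun a b => counit a * counit b).

Fact UU_neq0 : (1 : UU) != 0.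
Proof.
have linl b : linear (fun a => counit a * counit b).
  by move=> c a a'; rewrite counit_linear mulrDl -scalerAl.
have linr a : linear (fun b => counit a * counit b).
  by move=> c b b'; rewrite counit_linear mulrDr -scalerAr.
apply/eqP => /(congr1 counit2).
rewrite /counit2 (lin0 (tlift_linear linl linr)).
rewrite -[1]/(tpure 1 1) (tlift_pure linl linr) counit1 mulr1.
by move/eqP; rewrite oner_eq0.
Qed.

HB.instance Definition _ := GRing.PzSemiRing_isNonZero.Build UU UU_neq0.
HB.instance Definition _ :=
  GRing.LSemiModule_isLSemiAlgebra.Build k UU (@tensor_scaleAl k uzeta uzeta).
HB.instance Definition _ :=
  GRing.LSemiAlgebra_isSemiAlgebra.Build k UU (@tensor_scaleAr k uzeta uzeta).

(* The coproduct: the algebra map given on generators by the formulas below   *)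
(* (see coprodM, coprod_linear and the lemmas after them).                    *)
Definition coprod_gen (x : ugen) : UU :=
  match x with
  | GenE => tpure uE uK + tpure 1 uE
  | GenF => tpure uKinv uF + tpure uF 1
  | GenK => tpure uK uK
  end.
Definition coprod : uzeta -> UU := plift coprod_gen.

(* The antipode: an algebra map to the opposite algebra.                      *)
Definition antip_gen (x : ugen) : uzeta^c :=
  match x with
  | GenE => - (uE * uKinv)
  | GenF => - (uK * uF)
  | GenK => uKinv
  end.
Definition antip : uzeta -> uzeta := plift antip_gen.

Section HopfFacts.
Hypotheses (r_odd : odd r) (z_prim : r.-primitive_root z).

Let r_gt0 : (0 < r)%N. Proof. exact: odd_gt0. Qed.
Let rE : r.-1.+1 = r. Proof. exact: prednK. Qed.
Let z_neq0 : z != 0.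
Proof.
apply/eqP => z0; have /eqP := prim_expr_order z_prim.
by rewrite z0 expr0n -rE eq_sym oner_eq0.
Qed.

Let q := z ^- 2.
Let q_neq0 : q != 0. Proof. by rewrite invr_eq0 expf_neq0. Qed.
Let q_prim : r.-primitive_root q.
Proof.
have -> : q = z ^+ (r.-1 * 2).
  rewrite /q -exprVn exprM; congr (_ ^+ 2); apply: (mulfI z_neq0).
  by rewrite mulfV // -exprS rE prim_expr_order.
rewrite prim_root_exp_coprime // coprimeMl coprime2n r_odd andbT.
by rewrite coprimePn.
Qed.

Lemma uKinvE : uKinv * uE = q *: (uE * uKinv).
Proof.
have : uE * uKinv = z ^+ 2 *: (uKinv * uE).
  have /(congr1 (fun x => uKinv * x)) := uKEKinv.
  by rewrite -scalerAr !mulrA uKinvK mul1r.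
by move->; rewrite scalerA mulVf ?scale1r // expf_neq0.
Qed.
Lemma uKinvF : uKinv * uF = z ^+ 2 *: (uF * uKinv).
Proof.
have : uF * uKinv = q *: (uKinv * uF).
  have /(congr1 (fun x => uKinv * x)) := uKFKinv.
  by rewrite -scalerAr !mulrA uKinvK mul1r.
by move->; rewrite scalerA mulfV ?scale1r // expf_neq0.
Qed.

Fact coprod_rel s t : urel s t -> teval coprod_gen s = teval coprod_gen t.
Proof.
have KX n : tpure uK uK ^+ n = tpure (uK ^+ n) (uK ^+ n) :> UU.
  exact: tensor_expE.
have E2K x y a : a *: tpure x y = tpure (a *: x) y :> UU.
  by rewrite (linZ (tpure_linearl y)).
have E2K' x y a : a *: tpure x y = tpure x (a *: y) :> UU.
  by rewrite (linZ (tpure_linearr x)).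
have t0l x : tpure x 0 = 0 :> UU by exact: (lin0 (tpure_linearr x)).
have t0r x : tpure 0 x = 0 :> UU by exact: (lin0 (tpure_linearl x)).
case; rewrite ?tevalB ?tevalX /= ?tevalX /= -?/uKinv.
- rewrite rE; apply: (qbinomial_prim _ q_prim).
  + rewrite !tensor_mulE mul1r mulr1 uKE -E2K' scalerA mulVf ?scale1r //.
    exact: expf_neq0.
  + by rewrite tensor_expE -{1}rE uE_exp t0r.
  + by rewrite tensor_expE -{2}rE uE_exp t0l.
- rewrite rE; apply: (qbinomial_prim _ q_prim).
  + rewrite !tensor_mulE mul1r mulr1 uKinvF -E2K scalerA mulVf ?scale1r //.
    exact: expf_neq0.
  + by rewrite tensor_expE -{2}rE uF_exp t0l.
  + by rewrite tensor_expE -{1}rE uF_exp t0r.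
- by rewrite KX uK_exp.
- rewrite KX -!/uKinv mulrDr mulrDl !tensor_mulE mulr1 uKKinv uKEKinv.
  by rewrite -mulrA uKKinv mulr1 -E2K -E2K' scalerDr.
- rewrite KX -!/uKinv mulrDr mulrDl !tensor_mulE mulr1 uKKinv uKFKinv.
  by rewrite mul1r -E2K -E2K' scalerDr.
- rewrite KX -!/uKinv !mulrDl !mulrDr !tensor_mulE !mul1r !mulr1.
  rewrite uKF -E2K' uKinvE -E2K.
  have sub_l x y u : tpure (x - y) u = tpure x u - tpure y u :> UU.
    by rewrite addrC -scaleN1r tpure_linearl scaleN1r addrC.
  have sub_r x y u : tpure u (x - y) = tpure u x - tpure u y :> UU.
    by rewrite addrC -scaleN1r tpure_linearr scaleN1r addrC.
  have rearrange (x a a' b b' c : UU) :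
      x + a + (b + c) - (x + b' + (a' + c)) = (a - a') + (b - b').
    rewrite [x + b' + _]addrACA opprD addrACA; congr (_ + _).
      by rewrite opprD addrACA subrr add0r.
    by rewrite opprD addrACA subrr addr0.
  rewrite rearrange -sub_l -sub_r uEF_comm sub_l sub_r.
  by rewrite addrA subrK.
Qed.

Lemma coprod1 : coprod 1 = 1. Proof. exact: plift1 coprod_rel. Qed.
Lemma coprodM x y : coprod (x * y) = coprod x * coprod y.
Proof. exact: pliftM coprod_rel _ _. Qed.
Lemma coprod_linear : linear coprod. Proof. exact: plift_linear coprod_rel. Qed.
Lemma coprod_E : coprod uE = tpure uE uK + tpure 1 uE.
Proof. exact: plift_gen coprod_rel _. Qed.
Lemma coprod_F : coprod uF = tpure uKinv uF + tpure uF 1.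
Proof. exact: plift_gen coprod_rel _. Qed.
Lemma coprod_K : coprod uK = tpure uK uK.
Proof. exact: plift_gen coprod_rel _. Qed.

Fact antip_rel s t : urel s t -> teval antip_gen s = teval antip_gen t.
Proof.
have KKn n : uKinv ^+ n * uK ^+ n = 1.
  elim: n => [|n IHn]; first by rewrite !expr0 mulr1.
  by rewrite exprSr exprS -mulrA (mulrA uKinv) uKinvK mul1r IHn.
have KinvX : uKinv ^+ r.-1 = uK.
  by rewrite -[LHS]mulr1 -uK_exp exprSr mulrA KKn mul1r.
have uEr : uE ^+ r = 0 by rewrite -[X in _ ^+ X]rE uE_exp.
have uFr : uF ^+ r = 0 by rewrite -[X in _ ^+ X]rE uF_exp.
have revM (a b : uzeta^c) : a * b = (b : uzeta) * (a : uzeta) by [].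
case; rewrite ?tevalB ?tevalX /= ?tevalX /= ?revrX ?KinvX ?revM ?KinvX ?rE.
- have [c] := qcomm_exprM uKinvE r; rewrite exprNn => ->.
  by rewrite uEr mul0r scaler0 mulr0.
- have FK : uF * uK = z ^+ 2 *: (uK * uF).
    by rewrite uKF scalerA mulfV ?scale1r // expf_neq0.
  have [c] := qcomm_exprM FK r; rewrite exprNn => ->.
  by rewrite uFr mulr0 scaler0 mulr0.
- by rewrite -[LHS]mulr1 -uK_exp rE KKn.
- by rewrite !(mulrN, mulNr) scalerN !mulrA uKEKinv -scalerAl.
- by rewrite !(mulrN, mulNr) scalerN mulrA -!mulrA (mulrA uK uF) uKFKinv -scalerAr.
- rewrite !mulrNN.
  have -> : uK * uF * (uE * uKinv) = uF * uE.
    have -> : uK * uF * (uE * uKinv) = uK * uF * uKinv * (uK * uE * uKinv).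
      by rewrite -!mulrA (mulrA uKinv uK) uKinvK mul1r.
    rewrite uKFKinv uKEKinv -scalerAl -scalerAr scalerA mulVf ?scale1r //.
    exact: expf_neq0.
  rewrite -mulrA (mulrA uKinv) uKinvK mul1r -opprB uEF_comm opprB.
  by [].
Qed.

Lemma antip1 : antip 1 = 1. Proof. exact: plift1 antip_rel. Qed.
Lemma antipM x y : antip (x * y) = antip y * antip x.
Proof. exact: pliftM antip_rel _ _. Qed.
Lemma antip_linear : linear antip. Proof. exact: plift_linear antip_rel. Qed.
Lemma antip_E : antip uE = - (uE * uKinv).
Proof. exact: plift_gen antip_rel _. Qed.
Lemma antip_F : antip uF = - (uK * uF).
Proof. exact: plift_gen antip_rel _. Qed.
Lemma antip_K : antip uK = uKinv.
Proof. exact: plift_gen antip_rel _. Qed.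

End HopfFacts.
End SmallQuantumGroup.

Section AdjointAction.
Variables (k : fieldType) (r : nat) (z : k).
Local Notation U := (uzeta r z).

(* x |> y = x_(1) y S(x_(2)) *)
Definition ad (x y : U) : U := tlift (fun a b => a * y * antip b) (coprod x).

(* The iterated coproduct, with values in the tensor power with n.+1 factors. *)
Fixpoint icoprod (n : nat) : U -> tpow U n :=
  match n with
  | 0 => id
  | n'.+1 => fun x => tmap id (@icoprod n') (coprod x)
  end.

(* (x_0 (x) ... (x) x_n, y_0 (x) ... (x) y_n)                                 *)
(*    |-> (x_0 |> y_0) (x) ... (x) (x_n |> y_n)                               *)
Fixpoint adfactors (n : nat) : tpow U n -> tpow U n -> tpow U n :=
  match n with
  | 0 => ad
  | n'.+1 => fun X Y => tlift (fun x X' => tmap (ad x) (@adfactors n' X') Y) X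
  end.

Definition adpow (n : nat) (x : U) (Y : tpow U n) : tpow U n :=
  adfactors (icoprod n x) Y.

Section AdjointFacts.
Hypotheses (r_odd : odd r) (z_prim : r.-primitive_root z).

Let ad_in_linl y b : linear (fun a : U => a * y * antip b).
Proof. by move=> c a a'; rewrite mulrDl mulrDl -!scalerAl. Qed.
Let ad_in_linr y a : linear (fun b : U => a * y * antip b).
Proof. by move=> c b b'; rewrite (antip_linear r_odd) // mulrDr -scalerAr. Qed.

Lemma ad_linearl y : linear (ad^~ y).
Proof.
move=> c x x'; rewrite /ad (coprod_linear r_odd) //.
exact: (tlift_linear (ad_in_linl y) (ad_in_linr y)).
Qed.
Lemma ad_linearr x : linear (ad x).
Proof.
move=> c y y'; rewrite /ad; elim/tensor_ind: (coprod x) => [a b||u v IHu IHv|d u IHu].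
- rewrite !(tlift_pure (ad_in_linl _) (ad_in_linr _)).
  by rewrite mulrDr mulrDl -scalerAr -scalerAl.
- by rewrite !(lin0 (tlift_linear (ad_in_linl _) (ad_in_linr _))) scaler0 addr0.
- rewrite !(linD (tlift_linear (ad_in_linl _) (ad_in_linr _))) IHu IHv.
  by rewrite scalerDr addrACA.
- rewrite !(linZ (tlift_linear (ad_in_linl _) (ad_in_linr _))) IHu.
  by rewrite scalerDr !scalerA mulrC.
Qed.

Lemma icoprod_linear n : linear (@icoprod n).
Proof.
elim: n => [|n IHn] c x x' //=; rewrite (coprod_linear r_odd) //.
by apply: tlift_linear => u d a b; rewrite ?IHn ?tpure_linearl ?tpure_linearr.
Qed.

Lemma adfactors_bilinear n :
  (forall Y, linear ((@adfactors n)^~ Y)) /\ (forall X, linear (@adfactors n X)).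
Proof.
elim: n => [|n [IHl IHr]].
  by split; [exact: ad_linearl | exact: ad_linearr].
have inl x X' (w : tpow U n) :
    linear (fun v => tpure (ad x v) (adfactors X' w)).
  by move=> c a a'; rewrite ad_linearr tpure_linearl.
have inr x X' (v : U) : linear (fun w => tpure (ad x v) (@adfactors n X' w)).
  by move=> c a a'; rewrite IHr tpure_linearr.
have inE x X' := tlift_pure (inl x X') (inr x X').
have inL x X' := tlift_linear (inl x X') (inr x X').
have outl Y (X' : tpow U n) : linear (fun x => tmap (ad x) (adfactors X') Y).
  move=> c a a'; elim/tensor_ind: Y => [v w||u v IHu IHv|d u IHu].
  - by rewrite /tmap !inE ad_linearl tpure_linearl.
  - by rewrite /tmap !(lin0 (inL _ _)) scaler0 addr0.
  - by rewrite /tmap in IHu IHv *; rewrite !(linD (inL _ _)) IHu IHv scalerDr addrACA.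
  - by rewrite /tmap in IHu *; rewrite !(linZ (inL _ _)) IHu scalerDr !scalerA mulrC.
have outr Y x : linear (fun X' => tmap (ad x) (@adfactors n X') Y).
  move=> c a a'; elim/tensor_ind: Y => [v w||u v IHu IHv|d u IHu].
  - by rewrite /tmap !inE IHl tpure_linearr.
  - by rewrite /tmap !(lin0 (inL _ _)) scaler0 addr0.
  - by rewrite /tmap in IHu IHv *; rewrite !(linD (inL _ _)) IHu IHv scalerDr addrACA.
  - by rewrite /tmap in IHu *; rewrite !(linZ (inL _ _)) IHu scalerDr !scalerA mulrC.
split=> [Y|X]; first exact: (tlift_linear (outl Y) (outr Y)).
move=> c Y Y' /=; elim/tensor_ind: X => [x X'||u v IHu IHv|d u IHu].
- by rewrite !(tlift_pure (outl _) (outr _)) /tmap inL.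
- by rewrite !(lin0 (tlift_linear (outl _) (outr _))) scaler0 addr0.
- rewrite !(linD (tlift_linear (outl _) (outr _))) IHu IHv.
  by rewrite scalerDr addrACA.
- rewrite !(linZ (tlift_linear (outl _) (outr _))) IHu.
  by rewrite scalerDr !scalerA mulrC.
Qed.

Lemma adpow_linearl n (Y : tpow U n) : linear (fun x => adpow x Y).
Proof.
by move=> c x x'; rewrite /adpow icoprod_linear (adfactors_bilinear n).1.
Qed.
Lemma adpow_linearr n x : linear (@adpow n x).
Proof. exact: (adfactors_bilinear n).2. Qed.

End AdjointFacts.

Definition qbr (a : int) : k := z ^ a - z ^ (- a).
Definition qint (a : int) : k := qbr a / qbr 1.
Definition qfact (a : nat) : k := \prod_(1 <= i < a.+1) qint i.

Definition Epow (a : int) : U := if a is Posz b then uE r z ^+ b else 0.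
Definition Fdiv (a : int) : U :=
  if a is Posz b then
    if (b < r)%N then (qfact b)^-1 *: uF r z ^+ b else 0
  else 0.
Definition uT (a : int) : U :=
  r%:R^-1 *: \sum_(b < r) z ^ (2 * a * b%:Z) *: uK r z ^+ b.

(* E^l T_m F^(n), a tensor of g.+1 factors *)
Definition ETF (g : nat) (l m n : 'rV[int]_g.+1) : tpow U g :=
  tpures (fun j => Epow (l 0 j) * uT (m 0 j) * Fdiv (n 0 j)).

End AdjointAction.

Arguments ETF {k} r z {g} l m n.

Section Vectors.
Variable g : nat.
Implicit Type x : 'rV[int]_g.

Definition evec (j : 'I_g) : 'rV[int]_g := delta_mx 0 j.
Definition vsum x : int := \sum_(i < g) x 0 i.
Definition vsum_lt x (j : 'I_g) : int := \sum_(i < g | (i < j)%N) x 0 i.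
Definition vsum_gt x (j : 'I_g) : int := \sum_(i < g | (j < i)%N) x 0 i.
End Vectors.

(* exp(2 pi i / r) *)
Definition zeta (R : realType) (r : nat) : R[i] :=
  let t := 2 * pi / r%:R in (cos t +i* sin t)%C.

Lemma zeta_prim (R : realType) (r : nat) :
  (0 < r)%N -> r.-primitive_root (zeta R r).
Proof.
move=> r_gt0.
have r_neq0 : r%:R != 0 :> R by rewrite pnatr_eq0 -lt0n.
have zX i : zeta R r ^+ i =
    (cos (2 * pi / r%:R * i%:R) +i* sin (2 * pi / r%:R * i%:R))%C.
  elim: i => [|i IHi]; first by rewrite mulr0 cos0 sin0.
  have -> : 2 * pi / r%:R * i.+1%:R
          = 2 * pi / r%:R + 2 * pi / r%:R * i%:R :> R.
    by rewrite -[i.+1]add1n natrD; ring.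
  rewrite exprS IHi cosD sinD.
  apply/eqP; rewrite eq_complex /=; apply/andP; split; apply/eqP; ring.
have zX1 i : (i < r)%N -> zeta R r ^+ i = 1 -> i = 0%N.
  move=> lt_ir; case: i lt_ir => [//|i] lt_ir; rewrite zX.
  case=> /eqP + _; pose t : R := pi * (i.+1%:R / r%:R).
  have -> : 2 * pi / r%:R * i.+1%:R = t *+ 2 :> R by rewrite /t mulr2n; ring.
  have : 0 < sin t.
    apply: sin_gt0_pi; rewrite /t mulr_gt0 ?pi_gt0 ?divr_gt0 ?ltr0n //=.
    by rewrite gtr_pMr ?pi_gt0 // ltr_pdivrMr ?ltr0n // mul1r ltr_nat.
  rewrite cos_mulr2n cos2sin2 => /lt0r_neq0 sin_neq0 /eqP cos1.
  have /eqP : sin t ^+ 2 = 0 by lra.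
  by rewrite sqrf_eq0 (negPf sin_neq0).
have zr : zeta R r ^+ r = 1.
  by rewrite zX divfK // mulrC mulr_natr cos2pi sin2pi.
apply/andP; split=> //; apply/forallP => i; rewrite unity_rootE.
have [->|ir] := eqVneq i.+1 r; first by rewrite zr eqxx.
apply/eqP/negbTE/eqP => zi.
have lt_ir : (i.+1 < r)%N by rewrite ltn_neqAle ir ltn_ord.
by have := zX1 _ lt_ir zi.
Qed.

(* Main.v *)
(* On one factor, E |> y = EyK^-1 - yEK^-1, F |> y = Fy - K^-1 y K F and
   K |> y = KyK^-1, so the formulas for g = 1 follow from T_m E = E T_(m+1),
   F T_m = T_(m+1) F, T_m K = z^(-2m) T_m and the commutators of E with F^n and
   of F with E^l. On a tensor power, the iterated coproduct of E has K on the
   factors to the right of E, and that of F has K^-1 on the factors to the left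
   of F; as each E^l T_m F^(n) is an eigenvector of K, these factors only
   contribute powers of z.                                                    *)
Require Import Defs.
From mathcomp Require Import all_boot all_order all_algebra.
From mathcomp Require Import reals complex ring.

Set Implicit Arguments.
Unset Strict Implicit.
Unset Printing Implicit Defensive.

Import Order.TTheory GRing.Theory Num.Theory.
Local Open Scope ring_scope.

(** * Multilinear algebra of pure tensors *)

Section TensorFacts.
Variable k : fieldType.

Lemma tmap_pure (V W V' W' : lmodType k) (f : V -> V') (g : W -> W') v w :
  linear f -> linear g -> tmap f g (tpure v w) = tpure (f v) (g w).
Proof.
move=> f_lin g_lin; apply: (tlift_pure (f := fun v w => tpure (f v) (g w))).
  by move=> u c a a'; rewrite f_lin tpure_linearl.
by move=> u c a a'; rewrite g_lin tpure_linearr.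
Qed.

Lemma tmap_linear (V W V' W' : lmodType k) (f : V -> V') (g : W -> W') :
  linear f -> linear g -> linear (tmap f g).
Proof.
move=> f_lin g_lin; apply: tlift_linear.
  by move=> u c a a'; rewrite f_lin tpure_linearl.
by move=> u c a a'; rewrite g_lin tpure_linearr.
Qed.

Lemma eq_tpures (V : lmodType k) n (v w : 'I_n.+1 -> V) :
  v =1 w -> tpures v = tpures w.
Proof.
elim: n v w => [|n IHn] v w vw /=; first exact: vw.
by rewrite vw (IHn _ (fun i => w (lift ord0 i))).
Qed.

Lemma tpures_dfwith0 (V : lmodType k) n (v : 'I_n.+2 -> V) x :
  tpures (dfwith v (i := ord0) x) = tpure x (tpures (fun i => v (lift ord0 i))).
Proof.
rewrite /= dfwith_in; congr tpure; apply: eq_tpures => i.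
by rewrite dfwith_out ?neq_lift.
Qed.

Lemma tpures_dfwithS (V : lmodType k) n (v : 'I_n.+2 -> V) j x :
  tpures (dfwith v (i := lift ord0 j) x) =
  tpure (v ord0) (tpures (dfwith (fun i => v (lift ord0 i)) (i := j) x)).
Proof.
rewrite /= dfwith_out ?(eq_sym _ ord0) ?neq_lift //; congr tpure.
apply: eq_tpures => i; have [->|ij] := eqVneq i j; first by rewrite !dfwith_in.
by rewrite !dfwith_out ?(inj_eq lift_inj) // eq_sym.
Qed.

(** Multilinearity in slot j, which lets a sum computed in one factor be expanded outside the tensor
    product. *)
Lemma tpures_dfwith_linear (V : lmodType k) n (v : 'I_n.+1 -> V) j :
  linear (fun x => tpures (dfwith v (i := j) x)).
Proof.
elim: n v j => [|n IHn] v j c x y; first by rewrite (ord1 j) /= !dfwith_in.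
have [->|[j' ->]] : j = ord0 \/ exists j', j = lift ord0 j'.
  by case: (unliftP ord0 j) => [j' ->|->]; [right; exists j' | left].
- by rewrite !tpures_dfwith0 tpure_linearl.
- by rewrite !tpures_dfwithS IHn tpure_linearr.
Qed.

End TensorFacts.

(** * Adjoint action of the generators, on one factor and on pure tensors *)

Section Adjoint.
Variables (k : fieldType) (r : nat) (z : k).
Hypotheses (r_odd : odd r) (z_prim : r.-primitive_root z).
Local Notation U := (uzeta r z).
Local Notation E := (uE r z).
Local Notation F := (uF r z).
Local Notation K := (uK r z).
Local Notation Ki := (uKinv r z).

Lemma coprod_Kinv : coprod Ki = tpure Ki Ki.
Proof.
(* [Ki] is by definition the power r - 1 of K, so nonnegative powers suffice. *)
suff H i : coprod (K ^+ i) = tpure (K ^+ i) (K ^+ i) by exact: H.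
elim: i => [|i IHi]; first exact: coprod1 r_odd z_prim.
by rewrite !exprS (coprodM r_odd z_prim) IHi (coprod_K r_odd z_prim) tensor_mulE.
Qed.

Lemma antip_Kinv : antip Ki = K.
Proof.
have : antip Ki * antip K = 1.
  by rewrite -(antipM r_odd z_prim) uKKinv (antip1 r_odd z_prim).
rewrite (antip_K r_odd z_prim) => /(congr1 (fun x => x * K)).
by rewrite -mulrA uKinvK mulr1 mul1r.
Qed.

(** Bilinearity of (a, b) -> a y S(b), which [tlift] requires before [ad] can be evaluated on a
    coproduct. *)
Fact ad_in_linl (y b : U) : linear (fun a : U => a * y * antip b).
Proof. by move=> c a a'; rewrite mulrDl mulrDl -!scalerAl. Qed.
Fact ad_in_linr (y a : U) : linear (fun b : U => a * y * antip b).
Proof. by move=> c b b'; rewrite (antip_linear r_odd) // mulrDr -scalerAr. Qed.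

Let ad_pure y := tlift_pure (ad_in_linl y) (ad_in_linr y).
Let ad_linD y := linD (tlift_linear (ad_in_linl y) (ad_in_linr y)).

Lemma ad_1 (y : U) : ad 1 y = y.
Proof.
by rewrite /ad (coprod1 r_odd z_prim) ad_pure (antip1 r_odd z_prim) mul1r mulr1.
Qed.
Lemma ad_E (y : U) : ad E y = E * y * Ki - y * E * Ki.
Proof.
rewrite /ad (coprod_E r_odd z_prim) ad_linD !ad_pure.
by rewrite (antip_K r_odd z_prim) (antip_E r_odd z_prim) mul1r mulrN mulrA.
Qed.
Lemma ad_F (y : U) : ad F y = F * y - Ki * y * K * F.
Proof.
rewrite /ad (coprod_F r_odd z_prim) ad_linD !ad_pure.
rewrite (antip1 r_odd z_prim) (antip_F r_odd z_prim) mulr1 mulrN mulrA.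
by rewrite addrC.
Qed.
Lemma ad_K (y : U) : ad K y = K * y * Ki.
Proof. by rewrite /ad (coprod_K r_odd z_prim) ad_pure (antip_K r_odd z_prim). Qed.
Lemma ad_Kinv (y : U) : ad Ki y = Ki * y * K.
Proof. by rewrite /ad coprod_Kinv ad_pure antip_Kinv. Qed.

(** [adfactors] nests two lifts, one for the acting tensor and one for the tensor acted on;
    evaluating both needs linearity of the action in each argument. *)
Lemma adfactors_pure n x (X : tpow U n) y (Y : tpow U n) :
  adfactors (n := n.+1) (tpure x X) (tpure y Y) = tpure (ad x y) (adfactors X Y).
Proof.
have lin1 := ad_linearr r_odd z_prim.
have lin2 := (adfactors_bilinear r_odd z_prim n).2.
rewrite [LHS](tlift_pure (f := fun x X => tmap (ad x) (adfactors X) (tpure y Y))).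
- by rewrite tmap_pure.
- by move=> w c a a'; rewrite !tmap_pure // (ad_linearl r_odd z_prim) tpure_linearl.
- move=> w c a a'.
  by rewrite !tmap_pure // (adfactors_bilinear r_odd z_prim n).1 tpure_linearr.
Qed.

Let icoprodS_pure n (a b : U) :
  tmap id (@icoprod k r z n) (tpure a b) = tpure a (icoprod n b).
Proof. by rewrite tmap_pure //; exact: icoprod_linear. Qed.

Let icoprodS_linear n : linear (tmap (id : U -> U) (@icoprod k r z n)).
Proof. by apply: tmap_linear => //; exact: icoprod_linear. Qed.

Lemma adpow_1_pure n y (Y : tpow U n) :
  adpow (n := n.+1) 1 (tpure y Y) = tpure y (adpow 1 Y).
Proof.
rewrite /adpow [icoprod _ _]/= (coprod1 r_odd z_prim) icoprodS_pure.
by rewrite adfactors_pure ad_1.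
Qed.

Lemma adpow_K_pure n y (Y : tpow U n) :
  adpow (n := n.+1) K (tpure y Y) = tpure (ad K y) (adpow K Y).
Proof.
rewrite /adpow [icoprod _ _]/= (coprod_K r_odd z_prim) icoprodS_pure.
by rewrite adfactors_pure.
Qed.

(** Either E hits the first factor and K acts on the whole tail, or the first factor is untouched
    and E is passed on. *)
Lemma adpow_E_pure n y (Y : tpow U n) :
  adpow (n := n.+1) E (tpure y Y) =
  tpure (ad E y) (adpow K Y) + tpure y (adpow E Y).
Proof.
rewrite /adpow [icoprod _ _]/= (coprod_E r_odd z_prim).
rewrite (linD (@icoprodS_linear n)) !icoprodS_pure.
rewrite (linD ((adfactors_bilinear r_odd z_prim n.+1).1 _)).
by rewrite !adfactors_pure ad_1.
Qed.

(** Mirror image: passing F on to the tail conjugates the first factor by K^-1, while stopping F at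
    the first factor leaves 1 acting on the tail. *)
Lemma adpow_F_pure n y (Y : tpow U n) :
  adpow (n := n.+1) F (tpure y Y) =
  tpure (ad Ki y) (adpow F Y) + tpure (ad F y) (adpow 1 Y).
Proof.
rewrite /adpow [icoprod _ _]/= (coprod_F r_odd z_prim).
rewrite (linD (@icoprodS_linear n)) !icoprodS_pure.
rewrite (linD ((adfactors_bilinear r_odd z_prim n.+1).1 _)).
by rewrite !adfactors_pure.
Qed.

Lemma adpow_1_tpures n (v : 'I_n.+1 -> U) : adpow 1 (tpures v) = tpures v.
Proof.
elim: n v => [|n IHn] v; first exact: ad_1.
by rewrite [tpures v]/= adpow_1_pure IHn.
Qed.

Lemma adpow_K_tpures n (v : 'I_n.+1 -> U) w :
    (forall j, K * v j * Ki = w j *: v j) ->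
  adpow K (tpures v) = (\prod_j w j) *: tpures v.
Proof.
elim: n v w => [|n IHn] v w vw; first by rewrite big_ord1 /adpow /= ad_K vw.
rewrite [tpures v]/= adpow_K_pure ad_K vw (IHn _ _ (fun j => vw (lift ord0 j))).
rewrite (linZ (tpure_linearl _)) (linZ (tpure_linearr _)) scalerA.
by rewrite [in RHS]big_ord_recl.
Qed.

(** Unrolls [adpow_E_pure]: summand j collects the K-weights of the tail that remains when E stops
    at factor j. *)
Lemma adpow_E_tpures n (v : 'I_n.+1 -> U) w :
    (forall j, K * v j * Ki = w j *: v j) ->
  adpow E (tpures v) =
  \sum_(j < n.+1) (\prod_(i < n.+1 | (j < i)%N) w i) *: tpures (dfwith v (i := j) (ad E (v j))).
Proof.
elim: n v w => [|n IHn] v w vw.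
  by rewrite big_ord1 big_pred0 ?scale1r => [|i]; rewrite ?(ord1 i) //= dfwith_in.
rewrite [tpures v]/= adpow_E_pure (IHn _ _ (fun j => vw (lift ord0 j))) [in RHS]big_ord_recl.
rewrite tpures_dfwith0 (adpow_K_tpures (fun j => vw (lift ord0 j))); congr (_ + _).
  (* Index 0 fails 0 < i and every lifted index satisfies it, so the product runs over the whole
     tail. *)
  rewrite (linZ (tpure_linearr _)) [in RHS]big_mkcond [in RHS]big_ord_recl /=.
  by rewrite mul1r.
rewrite (big_morph _ (linD (tpure_linearr _)) (lin0 (tpure_linearr _))).
apply: eq_bigr => j _; rewrite tpures_dfwithS (linZ (tpure_linearr _)).
rewrite [in RHS]big_mkcond [in RHS]big_ord_recl /= mul1r -big_mkcond /=.
by congr (_ *: _); apply: eq_bigl => i.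
Qed.

Lemma adpow_F_tpures n (v : 'I_n.+1 -> U) w :
    (forall j, Ki * v j * K = w j *: v j) ->
  adpow F (tpures v) =
  \sum_(j < n.+1) (\prod_(i < n.+1 | (i < j)%N) w i) *: tpures (dfwith v (i := j) (ad F (v j))).
Proof.
elim: n v w => [|n IHn] v w vw.
  by rewrite big_ord1 big_pred0 ?scale1r => [|i]; rewrite ?(ord1 i) //= dfwith_in.
rewrite [tpures v]/= adpow_F_pure (IHn _ _ (fun j => vw (lift ord0 j))) [in RHS]big_ord_recl.
rewrite tpures_dfwith0 adpow_1_tpures addrC; congr (_ + _).
  by rewrite big_pred0 ?scale1r.
rewrite (big_morph _ (linD (tpure_linearr _)) (lin0 (tpure_linearr _))).
apply: eq_bigr => j _; rewrite tpures_dfwithS (linZ (tpure_linearr _)).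
rewrite ad_Kinv vw (linZ (tpure_linearl _)) scalerA.
(* Index 0 lies below every lifted j, which accounts for the K^-1 weight of the first factor. *)
rewrite [in RHS]big_mkcond [in RHS]big_ord_recl /= -big_mkcond /= mulrC.
by congr (_ * _ *: _); apply: eq_bigl => i.
Qed.
End Adjoint.

(** Cyclic reindexing, for sums over the powers of K modulo r. *)
Lemma sum_shift_periodic (V : nmodType) (f : nat -> V) n :
  f n = f 0 -> \sum_(i < n) f i.+1 = \sum_(i < n) f i.
Proof.
case: n => [|n] f_per; first by rewrite !big_ord0.
by rewrite big_ord_recr big_ord_recl /= f_per addrC.
Qed.

(** * Quantum integers and commutators with powers *)

Section QuantumIntegers.
Variables (k : fieldType) (z : k).
Hypotheses (z_neq0 : z != 0) (qbr1 : qbr z 1 != 0).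

Lemma qint1 : qint z 1 = 1.
Proof. exact: mulfV. Qed.

(** Since z - z^-1 = (z^2 - 1)/z, this is the denominator that [field] meets below. *)
Lemma sqr_neq1 : z * z - 1 != 0.
Proof.
apply: contra_neq qbr1 => z2; apply: (mulIf z_neq0).
by rewrite /qbr -exprnN expr1z mulrBl mulVf // z2 mul0r.
Qed.

(** Recursion for the coefficient of h in [qcomm_expr_comm] when one more y is appended: 1 from the
    new commutator, plus the earlier coefficient times z^-2 from moving h past y. [qint_rec] does
    the same for h'. *)
Lemma qint_recV (n : nat) :
  1 + qint z n.+1 * (z ^ (- n%:Z) / z ^+ 2) = qint z n.+2 * z ^ (- n.+1%:Z).
Proof.
have z2 := sqr_neq1.
rewrite /qint /qbr -!exprnN expr1z -!exprnP !exprS.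
have := expf_neq0 n z_neq0; move: (z ^+ n) => a a_neq0.
by field; apply/and3P.
Qed.

Lemma qint_rec (n : nat) :
  1 + qint z n.+1 * (z ^ n * z ^+ 2) = qint z n.+2 * z ^ n.+1.
Proof.
have z2 := sqr_neq1.
rewrite /qint /qbr -!exprnN expr1z -!exprnP !exprS.
have := expf_neq0 n z_neq0; move: (z ^+ n) => a a_neq0.
by field; apply/and3P.
Qed.

(* Symmetric in the roles of E and F: it gives [E, F^n] with (h, h') = (K, K^-1)
   and [F, E^n] with (h, h') = (K^-1, K).                                     *)
Lemma qcomm_expr_comm (A : algType k) (x y h h' : A) n :
    x * y = y * x + h - h' ->
    h * y = z ^- 2 *: (y * h) -> h' * y = z ^+ 2 *: (y * h') ->
  x * y ^+ n.+1 = y ^+ n.+1 * x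
    + qint z n.+1 *: (y ^+ n * (z ^ (- n%:Z) *: h - z ^ n *: h')).
Proof.
move=> xy hy h'y; elim: n => [|n IHn].
  by rewrite !expr1 qint1 expr0 mul1r !scale1r xy addrA.
rewrite exprSr mulrA IHn mulrDl -!mulrA xy -scalerAl -mulrA mulrBl -!scalerAl.
rewrite hy h'y !scalerA !mulrBr !mulrDr -!scalerAr !(mulrA _ y) -!exprSr.
rewrite -!addrA; congr (_ + _).
rewrite !scalerBr !scalerA -qint_recV -qint_rec !scalerDl !scale1r opprD !addrA.
by rewrite [_ - _ + _]addrAC.
Qed.

End QuantumIntegers.

(** * Commutation relations in the small quantum group *)

Section SingleFactor.
Variables (k : fieldType) (r : nat) (z : k).
Hypotheses (r_ge3 : (3 <= r)%N) (r_odd : odd r) (z_prim : r.-primitive_root z).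
Local Notation U := (uzeta r z).
Local Notation E := (uE r z).
Local Notation F := (uF r z).
Local Notation K := (uK r z).
Local Notation Ki := (uKinv r z).
Local Notation T := (uT r z).

Lemma prim_root_neq0 : z != 0.
Proof.
apply/eqP => z0; have /eqP := prim_expr_order z_prim.
by rewrite z0 expr0n gtn_eqF ?odd_gt0 // eq_sym oner_eq0.
Qed.
Let z_neq0 := prim_root_neq0.

(** Otherwise z^2 = 1 and r would divide 2. *)
Lemma qbr1_neq0 : qbr z 1 != 0.
Proof.
apply/eqP => /(congr1 (fun x => x * z)) /eqP.
rewrite /qbr -exprnN expr1z mulrBl mulVf // mul0r subr_eq0 -expr2.
rewrite -(prim_order_dvd z_prim) => /dvdn_leq => /(_ isT).
by rewrite leqNgt r_ge3.
Qed.

Lemma qint0 : qint z 0 = 0.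
Proof. by rewrite /qint /qbr oppr0 subrr mul0r. Qed.

(** If [a] vanished then z^(2a) = 1, so r would divide 2a, hence a because r is odd. *)
Lemma qint_neq0 (a : nat) : (0 < a < r)%N -> qint z a != 0.
Proof.
move=> /andP[a_gt0 a_lt]; rewrite mulf_neq0 ?invr_eq0 ?qbr1_neq0 //.
rewrite /qbr -exprnN -exprnP subr_eq0; apply/eqP => za.
have /eqP : z ^+ (2 * a) = 1.
  by rewrite mul2n -addnn exprD {1}za mulVf // expf_neq0.
rewrite -(prim_order_dvd z_prim) Gauss_dvdr ?coprimen2 // => /dvdn_leq.
by move/(_ a_gt0); rewrite leqNgt a_lt.
Qed.

Lemma expr_sq (i : nat) : (z ^+ 2) ^+ i = z ^ (2 * i%:Z).
Proof. by rewrite -exprM -PoszM. Qed.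
Lemma expr_sqV (i : nat) : (z ^- 2) ^+ i = z ^ (- 2 * i%:Z).
Proof. by rewrite exprVn expr_sq mulNr invr_expz. Qed.

Lemma uE_mulK : E * K = z ^- 2 *: (K * E).
Proof. by rewrite uKE scalerA mulVf ?scale1r ?expf_neq0. Qed.
Lemma uF_mulK : F * K = z ^+ 2 *: (K * F).
Proof. by rewrite uKF scalerA mulfV ?scale1r ?expf_neq0. Qed.

Lemma uF_expr : F ^+ r = 0.
Proof. by have := uF_exp r z; rewrite prednK ?odd_gt0. Qed.

Lemma uK_expr : K ^+ r = 1.
Proof. by have := uK_exp r z; rewrite prednK ?odd_gt0. Qed.

Lemma uT_mulK m : T m * K = z ^ (- 2 * m) *: T m.
Proof.
(* Chosen so that right multiplication by K turns summand i of T_m into [f i.+1], while scaling that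
   summand by z^(-2m) gives [f i]. *)
pose f (i : nat) : U := z ^ (2 * m * i%:Z - 2 * m) *: K ^+ i.
have f_per : f r = f 0.
  rewrite /f uK_expr expr0 mulr0 add0r expfzDr // [_ * r%:Z]mulrC.
  by rewrite -exprz_exp -exprnP (prim_expr_order z_prim) exp1rz mul1r.
rewrite /uT -scalerAl [RHS]scalerA [_ * r%:R^-1]mulrC -scalerA; congr (_ *: _).
rewrite mulr_suml scaler_sumr.
have -> : \sum_(i < r) (z ^ (2 * m * i%:Z) *: K ^+ i) * K = \sum_(i < r) f i.+1.
  apply: eq_bigr => i _; rewrite -scalerAl -exprSr; congr (z ^ _ *: _).
  by rewrite intS; ring.
have -> : \sum_(i < r) z ^ (- 2 * m) *: (z ^ (2 * m * i%:Z) *: K ^+ i) =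
    \sum_(i < r) f i.
  apply: eq_bigr => i _; rewrite scalerA -expfzDr //; congr (z ^ _ *: _).
  ring.
exact: sum_shift_periodic.
Qed.

Lemma uK_mulT m : K * T m = T m * K.
Proof.
rewrite /uT -scalerAl -scalerAr mulr_suml mulr_sumr; congr (_ *: _).
by apply: eq_bigr => i _; rewrite -scalerAl -scalerAr -exprSr exprS.
Qed.

(** Moving E past K^i costs z^(2i), which shifts the Fourier index m by one. *)
Lemma uT_mulE m : T m * E = E * T (m + 1).
Proof.
rewrite /uT -scalerAl -scalerAr mulr_suml mulr_sumr; congr (_ *: _).
apply: eq_bigr => i _; rewrite -scalerAl -scalerAr (qcomm_expr uE_mulK) scalerA.
rewrite expr_sqV -expfzDr //; congr (z ^ _ *: _); ring.
Qed.

Lemma uF_mulT m : F * T m = T (m + 1) * F.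
Proof.
rewrite /uT -scalerAl -scalerAr mulr_suml mulr_sumr; congr (_ *: _).
apply: eq_bigr => i _; rewrite -scalerAl -scalerAr (qcomm_expr uF_mulK) scalerA.
rewrite expr_sq -expfzDr //; congr (z ^ _ *: _); ring.
Qed.

Lemma uF_mulFdiv (n : nat) :
  F * Fdiv r z n = qint z (n%:Z + 1) *: Fdiv r z (n%:Z + 1).
Proof.
rewrite addrC -intS /Fdiv; have [n_lt|n_ge] := ltnP n r; last first.
  by rewrite ltnNge (leq_trans n_ge) // scaler0 mulr0.
rewrite -scalerAr -exprS; have [Sn_lt|Sn_ge] := ltnP n.+1 r; last first.
  (* Boundary n = r - 1: the left side vanishes by F^r = 0, the right side because F^(r) is zero by
     convention. *)
  have -> : n.+1 = r by apply/eqP; rewrite eqn_leq n_lt.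
  by rewrite uF_expr !scaler0.
rewrite scalerA; congr (_ *: _); rewrite /qfact [in RHS]big_nat_recr //=.
by rewrite invfM mulrCA mulfV ?mulr1 // qint_neq0.
Qed.

Lemma Fdiv_mulF (n : int) : Fdiv r z n * F = F * Fdiv r z n.
Proof.
rewrite /Fdiv; case: n => n; last by rewrite mul0r mulr0.
by case: ifP; rewrite ?mul0r ?mulr0 // -scalerAl -scalerAr -exprSr exprS.
Qed.

Lemma uK_mulEpow (l : int) : K * Epow r z l = z ^ (2 * l) *: (Epow r z l * K).
Proof.
rewrite /Epow; case: l => l; last by rewrite mul0r mulr0 scaler0.
by rewrite (qcomm_expr (uKE r z)) expr_sq.
Qed.

Lemma uK_mulFdiv (n : int) : K * Fdiv r z n = z ^ (- 2 * n) *: (Fdiv r z n * K).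
Proof.
rewrite /Fdiv; case: n => n; last by rewrite mul0r mulr0 scaler0.
case: ifP; rewrite ?mul0r ?mulr0 ?scaler0 // -scalerAl -scalerAr.
by rewrite (qcomm_expr (uKF r z)) expr_sqV !scalerA mulrC.
Qed.

(** The factor [n] in the commutator of E with F^n cancels against [n]!. The case n = r is excluded
    because F^(r) = 0 kills both products with E but leaves the term with F^(r-1). *)
Lemma uE_mulFdiv (n : int) : 0 <= n -> n != r%:Z ->
  Fdiv r z n * E = E * Fdiv r z n
    - Fdiv r z (n - 1) * (z ^ (1 - n) *: K - z ^ (n - 1) *: Ki).
Proof.
case: n => // n _ n_r.
rewrite /Fdiv. case: n n_r => [|n].
  by rewrite odd_gt0 // /qfact big_geq // invr1 scale1r mulr1 mul1r mul0r subr0.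
rewrite eqz_nat intS addrAC subrr add0r => n_r.
have [n_lt|n_ge] := ltnP n.+1 r; last first.
  (* The index n + 1 is at least r and differs from r, so n is at least r as well and both divided
     powers are zero. *)
  have r_le : (r <= n)%N by rewrite -ltnS ltn_neqAle eq_sym n_r.
  by rewrite ltnNge r_le !mul0r mulr0 subr0.
rewrite (ltnW n_lt) opprD addrA subrr add0r.
have EF : E * F = F * E + K - Ki.
  by rewrite -addrA -uEF_comm addrC subrK.
rewrite -scalerAr (qcomm_expr_comm z_neq0 qbr1_neq0 n EF (uKF r z)); last first.
  exact: uKinvF.
have -> : qfact z n.+1 = qfact z n * qint z n.+1 by rewrite /qfact big_nat_recr.
by rewrite scalerDr -!scalerAl scalerA invfM divfK ?qint_neq0 // addrK.
Qed.

Lemma uF_mulEpow (l : int) : 0 <= l ->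
  F * Epow r z l = Epow r z l * F
  - qint z l *: (Epow r z (l - 1) * (z ^ (l - 1) *: K - z ^ (1 - l) *: Ki)).
Proof.
case: l => // -[|l] _.
  by rewrite qint0 scale0r subr0 mulr1 mul1r.
rewrite intS addrAC subrr add0r.
have FE : F * E = E * F + Ki - K.
  by rewrite -addrA -(opprB K) -uEF_comm opprB addrC subrK.
rewrite (qcomm_expr_comm z_neq0 qbr1_neq0 l FE).
- by rewrite opprD addrA subrr add0r -intS -[in LHS]opprB mulrN scalerN.
- exact: uKinvE.
- exact: uKE.
Qed.

Lemma uE_mulEpow (l : int) : 0 <= l -> E * Epow r z l = Epow r z (l + 1).
Proof. by case: l => // l _; rewrite addrC -intS /Epow -exprS. Qed.
Lemma Epow_mulE (l : int) : 0 <= l -> Epow r z l * E = Epow r z (l + 1).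
Proof. by case: l => // l _; rewrite addrC -intS /Epow -exprSr. Qed.

Lemma mul_uKinv (x : U) a : x * K = z ^ (- a) *: x -> x * Ki = z ^ a *: x.
Proof.
move=> xK; rewrite -[x in RHS]mulr1 -(uKKinv r z) mulrA xK -scalerAl scalerA.
by rewrite -expfzDr // addrN scale1r.
Qed.

Lemma uTFdiv_mulK m n :
  T m * Fdiv r z n * K = z ^ (- (2 * (m - n))) *: (T m * Fdiv r z n).
Proof.
have tK := uT_mulK m; have Kf := uK_mulFdiv n.
move: (T m) (Fdiv r z n) tK Kf => t f tK Kf.
have -> : z ^ (- (2 * (m - n))) = z ^ (2 * n) * z ^ (- 2 * m).
  by rewrite -expfzDr //; congr (z ^ _); ring.
rewrite -scalerA scalerAl -tK -[t * K * f]mulrA Kf -scalerAr scalerA mulrA.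
by rewrite -expfzDr // mulNr addrN scale1r.
Qed.

(** * The action on one factor E^l T_m F^(n) *)

Definition ETF1 (l m n : int) : U := Epow r z l * T m * Fdiv r z n.

Lemma uK_mulETF1 l m n : K * ETF1 l m n = z ^ (2 * (l - n)) *: (ETF1 l m n * K).
Proof.
rewrite /ETF1; have Ke := uK_mulEpow l; have Kt := uK_mulT m.
have Kf := uK_mulFdiv n.
move: (Epow r z l) (T m) (Fdiv r z n) Ke Kt Kf => e t f Ke Kt Kf.
rewrite !mulrA Ke -!scalerAl -[e * K * t]mulrA Kt mulrA -[_ * K * f]mulrA Kf.
rewrite -scalerAr scalerA -expfzDr // mulrA.
by congr (z ^ _ *: _); ring.
Qed.

Lemma ETF1_mulK l m n : ETF1 l m n * K = z ^ (- (2 * (m - n))) *: ETF1 l m n.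
Proof. by rewrite /ETF1 -!mulrA (mulrA (T m)) uTFdiv_mulK -scalerAr. Qed.
Let ETF1_mulKinv l m n := mul_uKinv (ETF1_mulK l m n).

(** Conjugation by K is the grading with E in degree 1, F in degree -1 and T_m in degree 0. This
    eigenvalue and that of [ETF1_wtV] are the weights fed to [adpow_E_tpures] and
    [adpow_F_tpures]. *)
Lemma ETF1_wt l m n : K * ETF1 l m n * Ki = z ^ (2 * (l - n)) *: ETF1 l m n.
Proof.
rewrite uK_mulETF1; move: (ETF1 l m n) => x.
by rewrite -scalerAl -mulrA uKKinv mulr1.
Qed.

Lemma ETF1_wtV l m n : Ki * ETF1 l m n * K = z ^ (- 2 * (l - n)) *: ETF1 l m n.
Proof.
have := uK_mulETF1 l m n; move: (ETF1 l m n) => x Kx.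
rewrite -[LHS]scale1r -[1](expr0z z) -(addNr (2 * (l - n))) expfzDr // mulNr.
by rewrite -scalerA -mulrA scalerAr -Kx mulrA uKinvK mul1r.
Qed.

(** In E y K^-1 - y E K^-1 the first product gives the first term. In the second, moving E leftwards
    leaves a commutator with F^(n), the third term, and raises m on passing T_m. *)
Lemma ad_E_ETF1 l m n : 0 <= l -> 0 <= n -> n != r%:Z ->
  ad E (ETF1 l m n) =
    z ^ (2 * (m - n)) *: ETF1 (l + 1) m n
    - z ^ (2 * (m - n + 1)) *: ETF1 (l + 1) (m + 1) n
    - (qbr z (2 * m - n + 1) * z ^ (2 * (m - n + 1))) *: ETF1 l m (n - 1).
Proof.
move=> l_ge0 n_ge0 n_r; rewrite ad_E //.
have -> : E * ETF1 l m n = ETF1 (l + 1) m n.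
  by rewrite /ETF1 !mulrA uE_mulEpow.
have -> : ETF1 l m n * E = ETF1 (l + 1) (m + 1) n
    - ETF1 l m (n - 1) * (z ^ (1 - n) *: K - z ^ (n - 1) *: Ki).
  rewrite /ETF1 -[LHS]mulrA uE_mulFdiv // mulrBr !mulrA; congr (_ - _).
  by rewrite -[_ * T m * E]mulrA uT_mulE mulrA Epow_mulE.
have xK := ETF1_mulK l m (n - 1); have xKi := ETF1_mulKinv l m (n - 1).
rewrite mulrBl !ETF1_mulKinv.
move: (ETF1 (l + 1) m n) (ETF1 (l + 1) (m + 1) n) => a b.
move: (ETF1 l m (n - 1)) xK xKi => x xK xKi.
(* The right eigenvalue of K on x turns the bracket into z^(-(2m-n+1)) - z^(2m-n+1), that is
   -{2m-n+1}. *)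
have -> : x * (z ^ (1 - n) *: K - z ^ (n - 1) *: Ki) * Ki =
    ((z ^ (1 - n) * z ^ (- (2 * (m - (n - 1)))) -
      z ^ (n - 1) * z ^ (2 * (m - (n - 1)))) * z ^ (2 * (m - (n - 1)))) *: x.
  by rewrite mulrBr -2!scalerAr xK xKi !scalerA -scalerBl -scalerAl xKi scalerA.
rewrite opprB addrA addrAC; congr (_ *: _ - _ *: _ + _).
  by congr (z ^ _); ring.
rewrite -scaleNr -[- (qbr _ _ * _)]mulNr; congr (_ * z ^ _ *: _); last by ring.
by rewrite -!expfzDr // /qbr [RHS]opprB; congr (z ^ _ - z ^ _); ring.
Qed.

(** K^-1 y K F is y F times the conjugation weight, giving the first term. In F y, moving F
    rightwards past E^l leaves the commutator term, and passing T_m raises m. *)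
Lemma ad_F_ETF1 l m n : 0 <= l -> 0 <= n ->
  ad F (ETF1 l m n) =
    - (qint z (n + 1) * z ^ (- 2 * (l - n))) *: ETF1 l m (n + 1)
    + qint z (n + 1) *: ETF1 l (m + 1) (n + 1)
    - (qint z l * qbr z (l - 2 * m - 1)) *: ETF1 (l - 1) m n.
Proof.
move=> l_ge0 n_ge0; rewrite ad_F //.
have F_Fdiv : F * Fdiv r z n = qint z (n + 1) *: Fdiv r z (n + 1).
  by case: n n_ge0 => // n _; exact: uF_mulFdiv.
have xF : ETF1 l m n * F = qint z (n + 1) *: ETF1 l m (n + 1).
  by rewrite /ETF1 -mulrA Fdiv_mulF F_Fdiv -scalerAr.
have -> : Ki * ETF1 l m n * K * F =
    (qint z (n + 1) * z ^ (- 2 * (l - n))) *: ETF1 l m (n + 1).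
  rewrite ETF1_wtV [qint _ _ * _]mulrC -scalerA -xF.
  by move: (ETF1 l m n) => x; rewrite -scalerAl.
rewrite addrC scaleNr -addrA; congr (_ + _).
have tK := uT_mulK m; have tKi := @mul_uKinv (T m) (2 * m).
rewrite mulNr in tK; have {}tKi := tKi tK.
have Kt := uK_mulT m.
have Kit : Ki * T m = T m * Ki.
  have := Kt; move: (T m) => t Kt'.
  by rewrite -[LHS]mulr1 -(uKKinv r z) -!mulrA (mulrA t) -Kt' !mulrA uKinvK mul1r.
rewrite /ETF1 !mulrA uF_mulEpow // !mulrBl; congr (_ - _).
  by rewrite -[_ * F * T m]mulrA uF_mulT mulrA -[_ * F * Fdiv _ _ _]mulrA F_Fdiv -scalerAr.
move: (Epow r z (l - 1)) (T m) (Fdiv r z n) tK tKi Kt Kit => e t f tK tKi Kt Kit.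
rewrite -!scalerAl -scalerA; congr (_ *: _).
(* K and K^-1 act on T_m by z^(-2m) and z^(2m), so the bracket becomes the scalar {l-2m-1}. *)
rewrite -[e * _ * t]mulrA mulrBl -!scalerAl Kt Kit tK tKi !scalerA -scalerBl.
rewrite -scalerAr -scalerAl; congr (_ *: _).
by rewrite -!expfzDr // /qbr; congr (z ^ _ - z ^ _); ring.
Qed.

(** Collects the weights of several factors into a single exponent such as |l - n|_{>j}. *)
Lemma prodz_expz (I : finType) (P : pred I) (c : int) (f : I -> int) :
  \prod_(i | P i) z ^ (c * f i) = z ^ (c * \sum_(i | P i) f i).
Proof.
rewrite mulr_sumr; symmetry.
by apply: (big_morph (fun a => z ^ a)) => // a b; exact: expfzDr.
Qed.

(** * The formulas on tensor powers *)

Section Tensors.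
Variables (g : nat) (l m n : 'rV[int]_g.+1).
Local Notation v := (fun j => ETF1 (l 0 j) (m 0 j) (n 0 j)).

(** Serves to recognise a tensor changed in factor j alone as an [ETF] with vectors shifted by
    [evec j]. *)
Lemma tpures_dfwith_ETF1 (l' m' n' : 'rV[int]_g.+1) j :
    (forall i, i != j -> [/\ l' 0 i = l 0 i, m' 0 i = m 0 i & n' 0 i = n 0 i]) ->
  tpures (dfwith v (i := j) (ETF1 (l' 0 j) (m' 0 j) (n' 0 j))) = ETF r z l' m' n'.
Proof.
move=> agree; apply: eq_tpures => i.
have [->|ij] := eqVneq i j; first by rewrite dfwith_in.
by rewrite dfwith_out 1?eq_sym // /ETF1; case: (agree i ij) => -> -> ->.
Qed.

Let lin j := tpures_dfwith_linear v j.

Lemma tpures_dfwith_lincomb j a b c x y w :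
  tpures (dfwith v (i := j) (a *: x + b *: y + c *: w)) =
  a *: tpures (dfwith v (i := j) x) + b *: tpures (dfwith v (i := j) y)
  + c *: tpures (dfwith v (i := j) w).
Proof. by rewrite !(linD (lin j)) !(linZ (lin j)). Qed.

Hypotheses (l_ge0 : forall j, 0 <= l 0 j) (n_ge0 : forall j, 0 <= n 0 j).

Lemma adpow_K_ETF : adpow K (ETF r z l m n) = z ^ (2 * vsum (l - n)) *: ETF r z l m n.
Proof.
rewrite (adpow_K_tpures r_odd z_prim (fun j => ETF1_wt (l 0 j) (m 0 j) (n 0 j))).
rewrite prodz_expz; congr (z ^ (_ * _) *: _).
by apply: eq_bigr => i _; rewrite !mxE.
Qed.

Lemma adpow_E_ETF : (forall j, n 0 j != r%:Z) ->
  adpow E (ETF r z l m n) =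
  \sum_(j < g.+1) z ^ (2 * vsum_gt (l - n) j) *:
    (z ^ (2 * (m 0 j - n 0 j)) *: ETF r z (l + evec j) m n
     - z ^ (2 * (m 0 j - n 0 j + 1)) *: ETF r z (l + evec j) (m + evec j) n
     - (qbr z (2 * m 0 j - n 0 j + 1) * z ^ (2 * (m 0 j - n 0 j + 1))) *:
         ETF r z l m (n - evec j)).
Proof.
move=> n_r.
rewrite (adpow_E_tpures r_odd z_prim (fun j => ETF1_wt (l 0 j) (m 0 j) (n 0 j))).
apply: eq_bigr => j _; rewrite prodz_expz; congr (_ *: _).
  by congr (z ^ (_ * _)); apply: eq_bigr => i _; rewrite !mxE.
rewrite ad_E_ETF1 // -!scaleNr tpures_dfwith_lincomb.
rewrite -(@tpures_dfwith_ETF1 (l + evec j) m n j); last first.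
  by move=> i /negPf ij; rewrite !mxE eqxx ij addr0.
rewrite -(@tpures_dfwith_ETF1 (l + evec j) (m + evec j) n j); last first.
  by move=> i /negPf ij; rewrite !mxE eqxx ij !addr0.
rewrite -(@tpures_dfwith_ETF1 l m (n - evec j) j); last first.
  by move=> i /negPf ij; rewrite !mxE eqxx ij subr0.
by rewrite !mxE !eqxx.
Qed.

Lemma adpow_F_ETF :
  adpow F (ETF r z l m n) =
  \sum_(j < g.+1) z ^ (- 2 * vsum_lt (l - n) j) *:
    (- (qint z (n 0 j + 1) * z ^ (- 2 * (l 0 j - n 0 j))) *:
         ETF r z l m (n + evec j)
     + qint z (n 0 j + 1) *: ETF r z l (m + evec j) (n + evec j)
     - (qint z (l 0 j) * qbr z (l 0 j - 2 * m 0 j - 1)) *: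
         ETF r z (l - evec j) m n).
Proof.
rewrite (adpow_F_tpures r_odd z_prim (fun j => ETF1_wtV (l 0 j) (m 0 j) (n 0 j))).
apply: eq_bigr => j _; rewrite prodz_expz; congr (_ *: _).
  by congr (z ^ (_ * _)); apply: eq_bigr => i _; rewrite !mxE.
rewrite ad_F_ETF1 // -[- (_ *: ETF1 (_ - 1) _ _)]scaleNr tpures_dfwith_lincomb.
rewrite -(@tpures_dfwith_ETF1 l m (n + evec j) j); last first.
  by move=> i /negPf ij; rewrite !mxE eqxx ij addr0.
rewrite -(@tpures_dfwith_ETF1 l (m + evec j) (n + evec j) j); last first.
  by move=> i /negPf ij; rewrite !mxE eqxx ij !addr0.
rewrite -(@tpures_dfwith_ETF1 (l - evec j) m n j); last first.
  by move=> i /negPf ij; rewrite !mxE eqxx ij subr0.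
by rewrite !mxE !eqxx !scaleNr.
Qed.

End Tensors.
End SingleFactor.

(** The number of factors, at least 1, is written [g.+1]. The first formula asks that no n_j equal
    r: at n_j = r the left side is zero since F^(r) = 0, while the third term on the right still
    contains F^(r-1). *)
Theorem lemma5p2 (R : realType) (r g : nat) (r_ge3 : (3 <= r)%N) (r_odd : odd r)
    (l m n : 'rV[int]_g.+1)
    (l_ge0 : forall j, 0 <= l 0 j)
    (m_ge0 : forall j, 0 <= m 0 j)
    (n_ge0 : forall j, 0 <= n 0 j) :
  let z := zeta R r in
  [/\ (forall j, n 0 j != r%:Z) ->
      adpow (uE r z) (ETF r z l m n) =
      \sum_(j < g.+1) z ^ (2 * vsum_gt (l - n) j) *:
        (z ^ (2 * (m 0 j - n 0 j)) *: ETF r z (l + evec j) m n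
         - z ^ (2 * (m 0 j - n 0 j + 1)) *:
             ETF r z (l + evec j) (m + evec j) n
         - (qbr z (2 * m 0 j - n 0 j + 1) * z ^ (2 * (m 0 j - n 0 j + 1))) *:
             ETF r z l m (n - evec j)),
      adpow (uF r z) (ETF r z l m n) =
      \sum_(j < g.+1) z ^ (- 2 * vsum_lt (l - n) j) *:
        (- (qint z (n 0 j + 1) * z ^ (- 2 * (l 0 j - n 0 j))) *:
             ETF r z l m (n + evec j)
         + qint z (n 0 j + 1) *: ETF r z l (m + evec j) (n + evec j)
         - (qint z (l 0 j) * qbr z (l 0 j - 2 * m 0 j - 1)) *:
             ETF r z (l - evec j) m n)
    & adpow (uK r z) (ETF r z l m n) =
      z ^ (2 * vsum (l - n)) *: ETF r z l m n].
Proof.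
have z_prim := zeta_prim R (odd_gt0 r_odd).
by split=> [n_r||]; [exact: adpow_E_ETF | exact: adpow_F_ETF | exact: adpow_K_ETF].
Qed.
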